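(* Let $H$ be a separable infinite-dimensional complex Hilbert space, let $k\in\mathbb N$, let $\mathcal T=(T_1,\dots,T_k)\in B(H)^k$ be such that $\operatorname{Int}W_e(\mathcal T)\ne\emptyset$, and let $\varepsilon>0$ be fixed. Then there exists $\delta>0$ with the following property: if $B\subset(\mathbb N\times\mathbb N)\setminus\Delta$ is admissible, and $\{a_{nj}:(n,j)\in B\cup\Delta\}\subset\mathbb C^k$ satisfies (i) $a_{nn}\in\operatorname{Int}W_e(\mathcal T)$ and $\operatorname{dist}\{a_{nn},\partial W_e(\mathcal T)\}>\varepsilon$ for all $n\in\mathbb N$; (ii) $\sum_{j:(n,j)\in B}\|a_{nj}\|_\infty\le\delta$ for all $n\in\mathbb N$, and $\sum_{n:(n,j)\in B}\|a_{nj}\|_\infty\le\delta$ for all $j\in\mathbb N$, then there is an orthonormal basis $(u_n)_{n=1}^\infty$ of $H$ such that $$\langle\mathcal Tu_j,u_n\rangle=a_{nj}$$ for all $n,j\in\mathbb N$ with $(n,j)\in B\cup\Delta$.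
   Context: $B(H)$ is the space of bounded linear operators on $H$; $\mathbb N=\{1,2,\dots\}$. For $\mathcal T=(T_1,\dots,T_k)\in B(H)^k$ and $x,y\in H$, $\langle\mathcal Tx,y\rangle=(\langle T_1x,y\rangle,\dots,\langle T_kx,y\rangle)\in\mathbb C^k$. For $\lambda\in\mathbb C^k$, $\|\lambda\|_\infty=\max\{|\lambda_1|,\dots,|\lambda_k|\}$. The (joint) essential numerical range $W_e(\mathcal T)$ is the set of all $\lambda=(\lambda_1,\dots,\lambda_k)\in\mathbb C^k$ for which there exists an orthonormal sequence $(x_n)_{n=1}^\infty\subset H$ with $\lim_{n\to\infty}\langle T_tx_n,x_n\rangle=\lambda_t$ for $t=1,\dots,k$. $\operatorname{Int}$ and $\partial$ denote interior and topological boundary in $\mathbb C^k$, and $\operatorname{dist}$ the usual distance in $\mathbb C^k$. $\Delta=\{(n,n):n\in\mathbb N\}$. A set $B\subset(\mathbb N\times\mathbb N)\setminus\Delta$ is admissible if for every $m\in\mathbb N$ there exists $n\in\mathbb N$, $n>m$, such that $(j,n)\notin B$ and $(n,j)\notin B$ for all $j=1,\dots,m$. *)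

(* Defs.v *)
From HB Require Import structures.
From mathcomp Require Import all_boot all_order all_algebra.
From mathcomp Require Import all_classical all_reals all_analysis.
From mathcomp Require Import complex.
Import Order.TTheory GRing.Theory Num.Theory.
Import numFieldNormedType.Exports.

Set Implicit Arguments.
Unset Strict Implicit.
Unset Printing Implicit Defensive.

Local Open Scope classical_set_scope.
Local Open Scope ring_scope.
Local Open Scope complex_scope.

(* The generic instances for numFieldType are attached to the projections of
   the abstract structures, so they do not reach the concrete type R[i]. *)
#[warnings="-redundant-canonical-projection"]
HB.instance Definition _ (R : realType) := NormedModule.copy R[i] R[i]^o.

Section Space.
Variables (R : realType) (H : completeNormedModType R[i]).

Definition separable_space : Prop :=
  exists A : set H, countable A /\ dense A.

Definition infinite_dimensional : Prop :=
  forall (n : nat) (e : 'I_n -> H),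
    exists x : H, forall c : 'I_n -> R[i], x <> \sum_(i < n) c i *: e i.

Definition bounded_operator (S : {linear H -> H}) : Prop :=
  exists M : R, forall x : H, `|S x| <= M%:C * `|x|.

(* The inner product is linear in its first argument and conjugate-linear in
   its second; norms of H are elements of R[i], hence the root sqrtC. *)
Definition induces_norm (ip : {dot H for Num.conj}) : Prop :=
  forall x : H, `|x| = sqrtC (ip x x).

Variable ip : {dot H for Num.conj}.

Definition orthonormal_seq (u : nat -> H) : Prop :=
  forall m n : nat, ip (u m) (u n) = (m == n)%:R.

Definition span_seq (u : nat -> H) : set H :=
  [set x | exists (n : nat) (c : nat -> R[i]), x = \sum_(i < n) c i *: u i].

Definition orthonormal_basis (u : nat -> H) : Prop :=
  orthonormal_seq u /\ dense (span_seq u).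

Variables (k : nat) (T : 'I_k -> {linear H -> H}).

Definition tuple_ip (x y : H) : 'rV[R[i]]_k := \row_t ip (T t x) y.

Definition ess_num_range : set 'rV[R[i]]_k :=
  [set lam | exists x : nat -> H, orthonormal_seq x /\
     forall t : 'I_k, tuple_ip (x n) (x n) 0 t @[n --> \oo] --> lam 0 t].

End Space.

Section ComplexTuples.
Variables (R : realType) (k : nat).
Implicit Types (lam mu : 'rV[R[i]]_k) (A : set 'rV[R[i]]_k).

(* Normc.normc is the modulus as an element of R. *)
Definition sup_norm lam : R :=
  \big[Num.max/0]_(t < k) ComplexField.Normc.normc (lam 0 t).

Definition euclid_dist lam mu : R :=
  Num.sqrt (\sum_(t < k) ComplexField.Normc.normc (lam 0 t - mu 0 t) ^+ 2).

(* +oo when A is empty. *)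
Definition dist_set lam A : \bar R :=
  ereal_inf [set (euclid_dist lam mu)%:E | mu in A].

Definition boundary A : set 'rV[R[i]]_k := closure A `\` A°.

End ComplexTuples.

(* Indices start at 0 instead of 1: this is the usual condition "for every
   m >= 1 there is n > m with (j, n), (n, j) not in B for j = 1, ..., m" after
   shifting m, n and j by one. *)
Definition admissible (B : set (nat * nat)) : Prop :=
  forall m : nat, exists n : nat, (m < n)%N /\
    forall j : nat, (j <= m)%N -> ~ B (j, n) /\ ~ B (n, j).

(* Main.v *)
(* The basis is built inductively: each u_n is a small vector w_n, chosen to
   meet the conditions linking u_n to u_0, ..., u_(n-1), plus a large vector
   orthogonal, together with its images, to everything chosen so far.  Such a
   vector exists with prescribed values of <T_t x, x>, since a ball around
   a_nn lies in the essential numerical range: one approximates the values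
   along orthonormal sequences and compensates the error geometrically.  The
   fresh part of u_n contains a block with dual vectors for the forms <., u_n>,
   <T_t ., u_n> and <., T_t u_n>, so that later vectors can prescribe these.

   The norm of w_n is controlled by the moduli of the entries linking n to
   smaller indices, weighted by the Gram matrix of the dual vectors; a
   potential, whose growth is paid by the remaining column sums, keeps these
   weights bounded.  Completeness: by admissibility, after reordering, there
   are infinitely many indices free of conditions with respect to all smaller
   ones, and at those u_n absorbs a fixed fraction of the residual of a vector
   of a dense sequence.  The damage to the Gram matrix is harmless because the
   remaining entries of the old rows are tiny. *)
Require Import Defs.
From mathcomp Require Import all_boot all_order all_algebra.
From mathcomp Require Import all_classical all_reals all_analysis.
From mathcomp Require Import complex ring lra.
Import Order.TTheory GRing.Theory Num.Theory.
Import numFieldNormedType.Exports.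

Set Implicit Arguments.
Unset Strict Implicit.
Unset Printing Implicit Defensive.

Local Open Scope classical_set_scope.
Local Open Scope ring_scope.
Local Open Scope complex_scope.

Import ComplexField.Normc.

(** The obstacle is uniformity. A vector [w_n] can be completed to a unit vector with exact diagonal
    values only if its norm is below a threshold that does not depend on [n], while [w_n] is a
    combination of all earlier duals. The duals themselves cannot be frozen: to vanish under the
    forms at a new [u_n] they need multiples of its block subtracted. This adds to the Gram bound
    [G] a rank-one term proportional to [x l * x m], where [x l] bounds the forms between the duals
    of [l] and [w_n]. At an ordinary index [x l] is a multiple of [\sum_j b n j * G l j], so row [l]
    grows in proportion to the very entries [b n j] that have just been used up. An absorbing index
    uses up no entries, so nothing pays for it. *)

Section Modulus.
Variable R : rcfType.
Implicit Types z w : R[i].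

Lemma cnormE z : `|z| = (normc z)%:C.
Proof. by case: z. Qed.

Lemma normc_ge0 z : 0 <= normc z.
Proof. by case: z => a b; rewrite sqrtr_ge0. Qed.

Lemma normcB z w : normc (z - w) = normc (w - z).
Proof. by rewrite -normcN opprB. Qed.

Lemma normc_conj z : normc (conjc z) = normc z.
Proof. by case: z => a b /=; rewrite sqrrN. Qed.

Lemma normc_real (x : R) : normc x%:C = `|x|.
Proof. by rewrite /normc /= expr0n addr0 sqrtr_sqr. Qed.

Lemma normc_sum (I : Type) (s : seq I) (P : pred I) (F : I -> R[i]) :
  normc (\sum_(i <- s | P i) F i) <= \sum_(i <- s | P i) normc (F i).
Proof.
elim/big_rec2: _ => [|i x y _ le]; first by rewrite normc0.
by rewrite (le_trans (le_normcD _ _))// lerD2l.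
Qed.

Lemma normc_eq0 z : normc z <= 0 -> z = 0.
Proof. by move=> h; apply: eq0_normc; apply/eqP; rewrite eq_le h normc_ge0. Qed.

Lemma normc_sqr z : ((normc z) ^+ 2)%:C = z * conjc z.
Proof. by rewrite rmorphXn /= -cnormE sqr_normc. Qed.
End Modulus.

(** * Inner products, residuals and the forms attached to [T] *)

Section InnerProduct.
Variables (R : realType) (H : lmodType R[i]) (ip : {dot H for Num.conj}).
Implicit Types (x y z : H) (c : R[i]).

(** Real-valued, whereas the norm of [H] takes values in [R[i]]. It needs only an [lmodType], so
    completeness enters later as an explicit hypothesis. *)
Definition hnorm x : R := Num.sqrt (complex.Re (ip x x)).

Lemma ipC x y : ip y x = conjc (ip x y).
Proof. by rewrite hermC expr0 mul1r. Qed.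

Lemma ipDl x y z : ip (x + y) z = ip x z + ip y z.
Proof. exact: linearDl. Qed.
Lemma ipDr x y z : ip x (y + z) = ip x y + ip x z.
Proof. exact: linearDr. Qed.
Lemma ipZl c x y : ip (c *: x) y = c * ip x y.
Proof. exact: linearZl_LR. Qed.
Lemma ipZr c x y : ip x (c *: y) = conjc c * ip x y.
Proof. exact: linearZr_LR. Qed.

Lemma hnorm_ge0 x : 0 <= hnorm x.
Proof. exact: sqrtr_ge0. Qed.

Lemma hnorm_sqr x : (hnorm x ^+ 2)%:C = ip x x.
Proof.
have := dnorm_ge0 ip x; rewrite /hnorm; case: (ip x x) => a b.
by rewrite lecE /= => /andP[/eqP -> a0]; rewrite sqr_sqrtr.
Qed.

Lemma hnorm_eq0 x : hnorm x = 0 -> x = 0.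
Proof.
move=> h; have := hnorm_sqr x; rewrite h expr0n => /esym/eqP.
by rewrite dnorm_eq0 => /eqP.
Qed.

Lemma hnorm0 : hnorm 0 = 0.
Proof.
have := hnorm_sqr 0; rewrite linear0l => -[/eqP].
by rewrite sqrf_eq0 => /eqP.
Qed.

Lemma hnormZ c x : hnorm (c *: x) = normc c * hnorm x.
Proof.
apply/eqP; rewrite -(eqrXn2 (n:=2)) ?hnorm_ge0 ?mulr_ge0 ?normc_ge0 ?hnorm_ge0//.
apply/eqP/complexI; rewrite hnorm_sqr exprMn rmorphM /= hnorm_sqr normc_sqr.
by rewrite ipZl ipZr mulrA.
Qed.

Lemma hnormN x : hnorm (- x) = hnorm x.
Proof. by rewrite -scaleN1r hnormZ normcN normc1 mul1r. Qed.

Lemma hnormB x y : hnorm (x - y) = hnorm (y - x).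
Proof. by rewrite -hnormN opprB. Qed.

Lemma hnormD_sqr x y :
  hnorm (x + y) ^+ 2 = hnorm x ^+ 2 + hnorm y ^+ 2 + 2 * complex.Re (ip x y).
Proof.
apply: complexI; rewrite hnorm_sqr !rmorphD /= !hnorm_sqr ipDl !ipDr (ipC x y).
case: (ip x x) => a b; case: (ip y y) => a' b'; case: (ip x y) => p q.
by apply/eqP; rewrite eq_complex /=; apply/andP; split; apply/eqP; simpc; ring.
Qed.

Lemma hnormD_ortho x y : ip x y = 0 ->
  hnorm (x + y) ^+ 2 = hnorm x ^+ 2 + hnorm y ^+ 2.
Proof. by move=> h; rewrite hnormD_sqr h mulr0 addr0. Qed.

Lemma ip_le x y : normc (ip x y) <= hnorm x * hnorm y.
Proof.
have [->|y0] := eqVneq y 0.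
  by rewrite linear0r normc0 mulr_ge0 ?hnorm_ge0.
have ny : 0 < hnorm y.
  by rewrite lt_def hnorm_ge0 andbT; apply: contra y0 => /eqP/hnorm_eq0 ->.
rewrite -(ler_pXn2r (n:=2)) ?nnegrE ?mulr_ge0 ?normc_ge0 ?hnorm_ge0//.
pose c := ip x y / (hnorm y ^+ 2)%:C.
have ny2 : (hnorm y ^+ 2)%:C != 0 :> R[i] by rewrite hnorm_sqr dnorm_eq0.
have o : ip (x - c *: y) (c *: y) = 0.
  rewrite ipZr ipDl -scaleNr ipZl -hnorm_sqr /c mulNr divfK// subrr mulr0 //.
have := hnormD_ortho o; rewrite subrK exprMn hnormZ exprMn => ->.
rewrite mulrDl -[X in X <= _]add0r lerD ?mulr_ge0 ?exprn_ge0 ?hnorm_ge0//.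
rewrite /c normcM exprMn normcV normc_real ger0_norm ?exprn_ge0 ?hnorm_ge0//.
have h (a b : R) : b != 0 -> a ^+ 2 * (b ^- 2) ^+ 2 * b ^+ 2 * b ^+ 2 = a ^+ 2.
  by move=> b0; field.
by rewrite h// gt_eqF.
Qed.

Lemma normcRe (z : R[i]) : complex.Re z <= normc z.
Proof.
case: z => a b /=; rewrite (le_trans (ler_norm a))// -sqrtr_sqr ler_wsqrtr//.
by rewrite lerDl sqr_ge0.
Qed.

Lemma hnormD x y : hnorm (x + y) <= hnorm x + hnorm y.
Proof.
rewrite -(ler_pXn2r (n:=2)) ?nnegrE ?addr_ge0 ?hnorm_ge0// hnormD_sqr.
have := le_trans (normcRe (ip x y)) (ip_le x y); lra.
Qed.

Lemma hnorm_sum (I : Type) (s : seq I) (P : pred I) (F : I -> H) :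
  hnorm (\sum_(i <- s | P i) F i) <= \sum_(i <- s | P i) hnorm (F i).
Proof.
elim/big_rec2: _ => [|i x y _ le]; first by rewrite hnorm0.
by rewrite (le_trans (hnormD _ _))// lerD2l.
Qed.

Lemma ip_suml (I : Type) (s : seq I) (P : pred I) (F : I -> H) y :
  ip (\sum_(i <- s | P i) F i) y = \sum_(i <- s | P i) ip (F i) y.
Proof.
by elim/big_rec2: _ => [|i a b _ <-]; rewrite ?linear0l ?ipDl.
Qed.

Lemma ip_sumr (I : Type) (s : seq I) (P : pred I) (F : I -> H) x :
  ip x (\sum_(i <- s | P i) F i) = \sum_(i <- s | P i) ip x (F i).
Proof.
by elim/big_rec2: _ => [|i a b _ <-]; rewrite ?linear0r ?ipDr.
Qed.

Definition residual n (u : nat -> H) g := g - \sum_(i < n) ip g (u i) *: u i.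

Section Residual.
Variables (n : nat) (u : nat -> H) (g : H).
Hypothesis uo : forall i j, (i < n)%N -> (j < n)%N -> ip (u i) (u j) = (i == j)%:R.

Lemma residual_ortho i : (i < n)%N -> ip (residual n u g) (u i) = 0.
Proof.
move=> lt; rewrite ipDl -scaleN1r ipZl ip_suml (bigD1 (Ordinal lt))//=.
rewrite big1 ?addr0; last first.
  by move=> j ji; rewrite ipZl uo// (negPf (ji : (j : nat) != i)) mulr0.
by rewrite ipZl uo// eqxx mulr1 mulN1r subrr.
Qed.

Lemma residual_pyth :
  hnorm g ^+ 2 = hnorm (residual n u g) ^+ 2 + \sum_(i < n) normc (ip g (u i)) ^+ 2.
Proof.
have o : ip (residual n u g) (\sum_(i < n) ip g (u i) *: u i) = 0.
  by rewrite ip_sumr big1// => i _; rewrite ipZr residual_ortho// mulr0.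
rewrite -[in LHS](subrK (\sum_(i < n) ip g (u i) *: u i) g) (hnormD_ortho o).
congr (_ + _); apply: complexI; rewrite hnorm_sqr ip_suml rmorph_sum.
apply: eq_bigr => i _; rewrite ip_sumr (bigD1 i)//= big1 ?addr0.
  by rewrite ipZl ipZr uo// eqxx mulr1 normc_sqr.
move=> j ji; rewrite ipZl ipZr uo// eq_sym.
by rewrite (negPf (ji : (j : nat) != i)) !mulr0.
Qed.

Lemma residual_norm : hnorm (residual n u g) <= hnorm g.
Proof.
rewrite -(ler_pXn2r (n:=2)) ?nnegrE ?hnorm_ge0// residual_pyth lerDl.
by apply: sumr_ge0 => i _; apply: sqr_ge0.
Qed.
End Residual.

Variables (k : nat) (T : 'I_k -> {linear H -> H}).

(* The conjugate-linear slot carries T for the second family, so that the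
   adjoints of T are never needed. *)
Definition form (r : option (bool * 'I_k)) x y : R[i] :=
  match r with
  | None => ip x y
  | Some (false, t) => ip (T t x) y
  | Some (true, t) => ip x (T t y)
  end.

Definition adj (r : option (bool * 'I_k)) : option (bool * 'I_k) :=
  if r is Some (b, t) then Some (~~ b, t) else None.

Lemma formC r x y : form r y x = conjc (form (adj r) x y).
Proof. by case: r => [[[] t]|] /=; rewrite -ipC. Qed.

Lemma formDl r x y z : form r (x + y) z = form r x z + form r y z.
Proof. by case: r => [[[] t]|] /=; rewrite ?linearD ?ipDl. Qed.
Lemma formDr r x y z : form r x (y + z) = form r x y + form r x z.
Proof. by case: r => [[[] t]|] /=; rewrite -?ipDr //; congr (ip x _); apply: linearD. Qed.
Lemma formZl r c x y : form r (c *: x) y = c * form r x y.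
Proof. by case: r => [[[] t]|] /=; rewrite -?ipZl //; congr (ip _ y); apply: linearZ. Qed.
Lemma formZr r c x y : form r x (c *: y) = conjc c * form r x y.
Proof. by case: r => [[[] t]|] /=; rewrite -?ipZr //; congr (ip x _); apply: linearZ. Qed.
Lemma form0l r x : form r 0 x = 0.
Proof. by rewrite -[0](scale0r 0) formZl mul0r. Qed.
Lemma form0r r x : form r x 0 = 0.
Proof. by rewrite -[X in form _ _ X](scale0r 0) formZr conjc0 mul0r. Qed.
Lemma formNl r x y : form r (- x) y = - form r x y.
Proof. by rewrite -scaleN1r formZl mulN1r. Qed.
Lemma formNr r x y : form r x (- y) = - form r x y.
Proof. by rewrite -scaleN1r formZr rmorphN rmorph1 mulN1r. Qed.
Lemma formBl r x y z : form r (x - y) z = form r x z - form r y z.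
Proof. by rewrite formDl formNl. Qed.
Lemma formBr r x y z : form r x (y - z) = form r x y - form r x z.
Proof. by rewrite formDr formNr. Qed.

Lemma form_suml r (I : Type) (s : seq I) (P : pred I) (F : I -> H) y :
  form r (\sum_(i <- s | P i) F i) y = \sum_(i <- s | P i) form r (F i) y.
Proof.
by elim/big_rec2: _ => [|i a b _ <-]; rewrite ?form0l ?formDl.
Qed.

Lemma form_sumr r (I : Type) (s : seq I) (P : pred I) (F : I -> H) x :
  form r x (\sum_(i <- s | P i) F i) = \sum_(i <- s | P i) form r x (F i).
Proof.
by elim/big_rec2: _ => [|i a b _ <-]; rewrite ?form0r ?formDr.
Qed.

Variable K : R.
Hypothesis K1 : 1 <= K.
Hypothesis TK : forall t x, hnorm (T t x) <= K * hnorm x.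

(** [K1] lets the same constant serve the plain inner product. *)
Lemma form_le r x y : normc (form r x y) <= K * (hnorm x * hnorm y).
Proof.
case: r => [[[] t]|] /=; apply: (le_trans (ip_le _ _)).
- by rewrite mulrCA ler_wpM2l ?hnorm_ge0.
- by rewrite mulrA ler_wpM2r ?hnorm_ge0.
- by rewrite ler_peMl // mulr_ge0 ?hnorm_ge0.
Qed.

(** All cross terms vanish, in both orders since [adj] only permutes the forms. So every [form r] is
    additive on sums of decoupled vectors. *)
Definition decoupled x y := forall r, form r x y = 0.

Lemma decoupledC x y : decoupled x y -> decoupled y x.
Proof. by move=> d r; rewrite formC d conjc0. Qed.

Lemma decoupled0 x : decoupled 0 x.
Proof. by move=> r; rewrite form0l. Qed.

Lemma decoupledD x y z : decoupled x z -> decoupled y z -> decoupled (x + y) z.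
Proof. by move=> h h' r; rewrite formDl h h' addr0. Qed.

Lemma decoupledZ c x z : decoupled x z -> decoupled (c *: x) z.
Proof. by move=> h r; rewrite formZl h mulr0. Qed.

Lemma decoupledB x y z : decoupled x z -> decoupled y z -> decoupled (x - y) z.
Proof. by move=> h h' r; rewrite formBl h h' subr0. Qed.

Lemma decoupled_sum (I : Type) (s : seq I) (P : pred I) (F : I -> H) z :
  (forall i, P i -> decoupled (F i) z) ->
  decoupled (\sum_(i <- s | P i) F i) z.
Proof.
move=> h; apply: (big_ind (fun x => decoupled x z)) => //.
  exact: decoupled0.
by move=> x y; apply: decoupledD.
Qed.

End InnerProduct.

Lemma sqrtrVK (R : rcfType) (x : R) : 0 < x ->
  ((Num.sqrt x)^-1 * (Num.sqrt x)^-1 = x^-1)%R.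
Proof. by move=> x0; rewrite -invfM -expr2 sqr_sqrtr// ltW. Qed.

Lemma normc_lim0 (R : rcfType) (z : R[i]) :
  (forall e : R, 0 < e -> normc z <= e) -> z = 0.
Proof.
move=> h; apply: normc_eq0; apply/ler_addgt0Pr => e e0; rewrite add0r.
exact: h.
Qed.

(** * Dependent choice and tails of real series *)

Section Sequences.
Variable R : realType.
Implicit Types (s : nat -> R) (C e : R).

Lemma dependent_choice_seq (A : Type) (P : nat -> A -> Prop)
    (Q : nat -> A -> A -> Prop) :
  (exists a, P 0 a) ->
  (forall n a, P n a -> exists b, P n.+1 b /\ Q n a b) ->
  exists f : nat -> A, forall n, P n (f n) /\ Q n (f n) (f n.+1).
Proof.
move=> [a0 Pa0] step.
have /choice[g gP] (p : nat * A) : exists b, P p.1 p.2 ->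
    P p.1.+1 b /\ Q p.1 p.2 b.
  case: p => n a /=; have [Pa|Pa] := pselect (P n a); last by exists a.
  by have [b] := step n a Pa; exists b.
pose f := fix f n := if n is n'.+1 then g (n', f n') else a0.
have fP n : P n (f n) by elim: n => [//|n Pn] /=; case: (gP (n, f n) Pn).
by exists f => n; split=> //=; case: (gP (n, f n) (fP n)).
Qed.

(** [F n] is the sum from [n] on, realised as supremum minus partial sum. The recursion is the form
    in which the potential spends it. *)
Lemma series_tail s C : (forall n, 0 <= s n) ->
    (forall n, \sum_(i < n) s i <= C) ->
  exists F : nat -> R, [/\ forall n, F n = s n + F n.+1, forall n, 0 <= F n,
    F 0 <= C & forall e, 0 < e -> exists n0, forall n, (n0 <= n)%N -> F n <= e].
Proof.
move=> s0 sC; pose S n := \sum_(i < n) s i.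
pose E := [set x | exists n, x = S n]%classic.
have E0 : (E !=set0)%classic by exists 0, 0%N; rewrite /S big_ord0.
have ubE : ubound E C by move=> _ [n ->]; apply: sC.
have hE : has_sup E by split=> //; exists C.
have leS n : S n <= sup E by apply: ub_le_sup; [exists C|exists n].
exists (fun n => sup E - S n); split=> [n|n||e e0].
- by rewrite /S big_ord_recr /=; ring.
- by rewrite subr_ge0.
- by rewrite /S big_ord0 subr0; apply: ge_sup.
have [_ [n0 ->] lt] := sup_adherent e0 hE.
exists n0 => n le; have : S n0 <= S n; last by lra.
rewrite /S -(subnKC le); elim: (n - n0)%N => [|d]; first by rewrite addn0.
by move=> /le_trans; apply; rewrite addnS big_ord_recr /= lerDl.
Qed.

Lemma summable_terms s C : (forall n, 0 <= s n) ->
    (forall n, \sum_(i < n) s i <= C) ->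
  forall e, 0 < e -> exists n0, forall n, (n0 <= n)%N -> s n <= e.
Proof.
move=> s0 sC e e0; have [F [Fs F0 _ Fl]] := series_tail s0 sC.
have [n0 h] := Fl e e0; exists n0 => n /h; rewrite Fs.
by have := F0 n.+1; lra.
Qed.

Lemma half_lim C e : 0 <= C -> 0 < e ->
  exists n0, forall n, (n0 <= n)%N -> C * 2^-1 ^+ n <= e.
Proof.
move=> C0 e0; apply: (@summable_terms _ (2 * C)) => // n.
  by rewrite mulr_ge0 // exprn_ge0 // invr_ge0.
have -> : \sum_(i < n) C * 2^-1 ^+ i = 2 * C - 2 * (C * 2^-1 ^+ n).
  elim: n => [|n IH]; first by rewrite big_ord0 expr0; ring.
  by rewrite big_ord_recr /= IH exprS; field.
by rewrite gerBl !mulr_ge0 // exprn_ge0 // invr_ge0.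
Qed.

Lemma eventually_all (I : finType) (P : I -> nat -> Prop) :
  (forall i, exists n0, forall n, (n0 <= n)%N -> P i n) ->
  exists n0, forall n, (n0 <= n)%N -> forall i, P i n.
Proof.
move=> /choice[f fP]; exists (\max_i f i)%N => n le i.
by apply: fP; apply: leq_trans le; apply: leq_bigmax.
Qed.

End Sequences.

(** * Unit vectors with prescribed values, and their dual blocks *)

Section Construction.
Variables (R : realType) (H : lmodType R[i]) (ip : {dot H for Num.conj}).
Variables (k : nat) (T : 'I_k -> {linear H -> H}).
Variable K : R.
Hypothesis K1 : 1 <= K.
Hypothesis TK : forall t x, hnorm ip (T t x) <= K * hnorm ip x.

Local Notation nm := (hnorm ip).
Local Notation form := (form ip T).
Local Notation decoupled := (decoupled ip T).
Local Notation form_le := (form_le K1 TK).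

Let K0 : 0 <= K. Proof. by rewrite (le_trans ler01). Qed.

Definition essential (lam : 'I_k -> R[i]) := exists x : nat -> H,
  (forall m n, ip (x m) (x n) = (m == n)%:R) /\
  forall t e, 0 < e -> exists n0, forall n, (n0 <= n)%N ->
    normc (ip (T t (x n)) (x n) - lam t) <= e.

(** Induction on [L]: a new functional either is nonzero somewhere on the common kernel of the
    others, and a multiple of that vector repairs its value without touching theirs, or it vanishes
    there already. The constant must not depend on [x], as the lemma is applied along an orthonormal
    sequence. *)
Lemma kill_functionals (L : seq (option (bool * 'I_k) * H)) :
  exists2 C, 0 <= C & forall x, exists x',
    (forall p, p \in L -> form p.1 x' p.2 = 0) /\
    nm (x - x') <= C * \sum_(p <- L) normc (form p.1 x p.2).
Proof.
elim: L => [|[r z] L [C C0 IH]].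
  by exists 0 => // x; exists x; split=> //; rewrite subrr hnorm0 mul0r.
have [[y [yL yz]]|none] :=
  pselect (exists y, (forall p, p \in L -> form p.1 y p.2 = 0) /\ form r y z != 0).
  pose y1 := (form r y z)^-1 *: y.
  have y1z : form r y1 z = 1 by rewrite formZl mulVf.
  have y1L p : p \in L -> form p.1 y1 p.2 = 0.
    by move=> /yL h; rewrite formZl h mulr0.
  have Cz : 0 <= K * (C * nm z) by rewrite !mulr_ge0 ?hnorm_ge0.
  exists (C + (1 + K * (C * nm z)) * nm y1).
    by rewrite addr_ge0 ?mulr_ge0 ?hnorm_ge0// addr_ge0.
  move=> x; have [x' [x'L x'x]] := IH x.
  exists (x' - form r x' z *: y1); split=> [p|].
    rewrite inE => /orP[/eqP -> /=|pL].
      by rewrite formBl formZl y1z mulr1 subrr.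
    by rewrite formBl formZl x'L// y1L// mulr0 subr0.
  rewrite big_cons /=; set S := \sum_(_ <- _) _ in x'x *.
  have S0 : 0 <= S by apply: sumr_ge0 => p _; apply: normc_ge0.
  have hx' : normc (form r x' z) <= normc (form r x z) + K * (C * nm z) * S.
    have -> : form r x' z = form r x z - form r (x - x') z.
      by rewrite formBl opprB addrC subrK.
    rewrite (le_trans (le_normcD _ _))// lerD2l normcN (le_trans (form_le _ _ _))//.
    by rewrite -mulrA ler_wpM2l // mulrAC ler_wpM2r ?hnorm_ge0.
  rewrite opprB addrCA [X in nm X](_ : _ = (x - x') + form r x' z *: y1); last first.
    by rewrite addrC.
  rewrite (le_trans (hnormD _ _ _))// hnormZ.
  have : normc (form r x' z) * nm y1 <=
      (normc (form r x z) + K * (C * nm z) * S) * nm y1.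
    by rewrite ler_wpM2r ?hnorm_ge0.
  have : 0 <= C * normc (form r x z) by rewrite mulr_ge0 ?normc_ge0.
  have : 0 <= K * (C * nm z) * normc (form r x z) * nm y1.
    by rewrite !mulr_ge0 ?normc_ge0 ?hnorm_ge0.
  have : 0 <= S * nm y1 by rewrite mulr_ge0 ?hnorm_ge0.
  nra.
exists C => // x; have [x' [x'L x'x]] := IH x; exists x'; split=> [p|].
  rewrite inE => /orP[/eqP -> /=|/x'L //].
  by apply/eqP/negP => /negP h; apply: none; exists x'.
by rewrite (le_trans x'x)// ler_wpM2l// big_cons lerDr normc_ge0.
Qed.

(** Bessel's inequality without adjoints: the test vector [y] has squared norm [S] and value [S]
    under [form r y z], whence [S ^+ 2 <= (K * nm z) ^+ 2 * S]. *)
Lemma form_orthonormal_lim (x : nat -> H) r z :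
  (forall m n, ip (x m) (x n) = (m == n)%:R) ->
  forall e, 0 < e -> exists n0, forall n, (n0 <= n)%N ->
    normc (form r (x n) z) <= e.
Proof.
move=> xo e e0; pose f n := form r (x n) z.
have bessel n : \sum_(i < n) normc (f i) ^+ 2 <= (K * nm z) ^+ 2.
  pose y := \sum_(i < n) conjc (f i) *: x i.
  set S := \sum_(i < n) _.
  have S0 : 0 <= S by apply: sumr_ge0 => i _; rewrite sqr_ge0.
  have fy : form r y z = S%:C.
    rewrite form_suml rmorph_sum; apply: eq_bigr => i _.
    by rewrite formZl mulrC /= normc_sqr.
  have yS : nm y ^+ 2 = S.
    apply: complexI; rewrite hnorm_sqr -[ip y y]/(form None y y) form_suml rmorph_sum.
    apply: eq_bigr => i _; rewrite form_sumr (bigD1 i) //= big1 ?addr0.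
      by rewrite ipZl ipZr xo eqxx mulr1 conjcK mulrC normc_sqr.
    by move=> j ji; rewrite /= ipZl ipZr xo eq_sym (negPf ji : (j == i :> nat) = false) !mulr0.
  have := form_le r y z; rewrite fy normc_real ger0_norm// => h.
  have h2 : S ^+ 2 <= (K * nm z) ^+ 2 * S.
    rewrite -{2}yS -exprMn ler_pXn2r ?nnegrE ?mulr_ge0 ?hnorm_ge0//.
    by rewrite -mulrA [nm z * _]mulrC.
  have [->|Sn0] := eqVneq S 0; first by rewrite sqr_ge0.
  have Sp : 0 < S by rewrite lt_def Sn0.
  by rewrite -(ler_pM2r Sp) -expr2.
have [n0 h] := summable_terms (fun n => sqr_ge0 (normc (f n))) bessel
  (exprn_gt0 2 e0).
exists n0 => n /h; rewrite ler_pXn2r ?nnegrE ?normc_ge0// ltW//.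
Qed.

Lemma essential_approx lam (V : seq H) e : essential lam -> 0 < e ->
  exists x, [/\ nm x = 1, forall z, z \in V -> decoupled x z &
    forall t, normc (ip (T t x) x - lam t) <= e].
Proof.
move=> [x [xo xl]] e0.
pose L := [seq (r, z) | r <- enum {: option (bool * 'I_k)}, z <- V].
have [C C0 kill] := kill_functionals L.
have sumL d : 0 < d -> exists n0, forall n, (n0 <= n)%N ->
    \sum_(p <- L) normc (form p.1 (x n) p.2) <= d.
  elim: L d {kill} => [|[r z] L IH] d d0.
    by exists 0%N => n _; rewrite big_nil ltW.
  have d2 : 0 < d / 2 by rewrite divr_gt0.
  have [n0 h0] := IH _ d2; have [n1 h1] := form_orthonormal_lim r z xo d2.
  exists (maxn n0 n1) => n; rewrite geq_max => /andP[/h0 a /h1 b].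
  by rewrite big_cons /=; lra.
(* [tau <= 1/2] keeps [x'] away from 0. The normalised vector is within [2 * tau] of [y], which
   changes the values by at most [4 * K * tau <= e / 2]. *)
pose tau := e / (8 * K + 2 * e).
have den0 : 0 < 8 * K + 2 * e by have := K1; lra.
have tau0 : 0 < tau by rewrite divr_gt0.
have tau1 : tau <= 2^-1 by rewrite ler_pdivrMr//; have := K1; nra.
have tauK : 4 * K * tau <= e / 2.
  by rewrite mulrA ler_pdivrMr//; nra.
have [n0 h0] := sumL (tau / (C + 1)) (divr_gt0 tau0 (ltr_pwDr ltr01 C0)).
have e2 : 0 < e / 2 by rewrite divr_gt0.
have [n1 h1] := eventually_all (fun t => xl t _ e2).
pose n := maxn n0 n1; have := h0 n (leq_maxl _ _); have := h1 n (leq_maxr _ _).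
set y := x n => hT hL.
have Ny : nm y = 1.
  have := hnorm_sqr ip y; rewrite xo eqxx => -[] /eqP.
  by rewrite sqrf_eq1 => /orP[/eqP //|/eqP h]; have := hnorm_ge0 ip y; lra.
have [x' [x'L x'x]] := kill y.
have {}x'x : nm (y - x') <= tau.
  apply: (le_trans x'x); apply: (@le_trans _ _ (C * (tau / (C + 1)))).
    by rewrite ler_wpM2l.
  by rewrite mulrA ler_pdivrMr ?ltr_pwDr//; nra.
have Nx' : `|1 - nm x'| <= tau.
  have := hnormD ip (y - x') x'; have := hnormD ip (x' - y) y.
  rewrite !subrK Ny hnormB => a b; rewrite ler_norml; apply/andP; split; lra.
have Nx'0 : 0 < nm x' by move: Nx'; rewrite ler_norml => /andP[]; lra.
pose w := (nm x')^-1%:C *: x'.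
have Nw : nm w = 1.
  by rewrite hnormZ normc_real ger0_norm ?invr_ge0 ?ltW// mulVf ?gt_eqF.
exists w; split=> // [z zV r|t].
  by rewrite formZl (x'L (r, z)) ?mulr0//; apply/allpairsP; exists (r, z); rewrite /= mem_enum.
have wy : nm (w - y) <= 2 * tau.
  have -> : w - y = (w - x') - (y - x') by rewrite opprB addrA subrK.
  rewrite (le_trans (hnormD _ _ _))// hnormN.
  have -> : w - x' = ((nm x')^-1 - 1)%:C *: x'.
    by rewrite rmorphB scalerBl scale1r.
  rewrite hnormZ normc_real -(ger0_norm (hnorm_ge0 ip x')) -normrM mulrBl mul1r.
  by rewrite (ger0_norm (hnorm_ge0 ip x')) mulVf ?gt_eqF//; lra.
have -> : ip (T t w) w - lam t =
    (form (Some (false, t)) (w - y) w + form (Some (false, t)) y (w - y)) +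
    (ip (T t y) y - lam t).
  by rewrite formBl formBr /=; ring.
have := form_le (Some (false, t)) (w - y) w.
have := form_le (Some (false, t)) y (w - y).
rewrite Nw Ny mulr1 mul1r => a b.
have c : K * nm (w - y) <= K * (2 * tau) by rewrite ler_wpM2l.
rewrite (le_trans (le_normcD _ _))//.
have := le_normcD (form (Some (false, t)) (w - y) w) (form (Some (false, t)) y (w - y)).
have := hT t; lra.
Qed.

Hypothesis complete : forall s : nat -> H,
  (forall e, 0 < e -> exists n0, forall m n, (n0 <= m)%N -> (m <= n)%N ->
    nm (s n - s m) <= e) ->
  exists l, forall e, 0 < e -> exists n0, forall n, (n0 <= n)%N ->
    nm (s n - l) <= e.

Lemma form_lim (s : nat -> H) l r v :
  (forall e, 0 < e -> exists n0, forall n, (n0 <= n)%N -> nm (s n - l) <= e) ->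
  (forall e, 0 < e -> exists n0, forall n, (n0 <= n)%N ->
    normc (form r (s n) (s n) - v) <= e) ->
  form r l l = v.
Proof.
move=> sl sv; apply/eqP; rewrite -subr_eq0; apply/eqP/normc_lim0 => e e0.
pose M := K * (2 * nm l + 1).
have M0 : 0 <= M by rewrite mulr_ge0// addr_ge0 ?mulr_ge0 ?hnorm_ge0.
have den : 0 < 2 * M + e by lra.
pose d := e / (2 * M + e).
have d0 : 0 < d by rewrite divr_gt0.
have d1 : d <= 1 by rewrite ler_pdivrMr//; lra.
have dM : M * d <= e / 2 by rewrite mulrA ler_pdivrMr//; nra.
have e2 : 0 < e / 2 by rewrite divr_gt0.
have [n0 h0] := sl d d0; have [n1 h1] := sv _ e2.
pose n := maxn n0 n1.
have := h0 n (leq_maxl _ _); have := h1 n (leq_maxr _ _).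
set y := s n => hv hy.
have -> : form r l l - v = - (form r (y - l) l + form r y (y - l)) +
    (form r y y - v) by rewrite formBl formBr; ring.
have ny : nm y <= nm l + d.
  by have := hnormD ip (y - l) l; rewrite subrK; lra.
rewrite (le_trans (le_normcD _ _))// normcN.
have := form_le r (y - l) l; have := form_le r y (y - l).
have : K * (nm y * nm (y - l)) <= K * ((nm l + 1) * d).
  rewrite ler_wpM2l// ler_pM ?hnorm_ge0//; lra.
have : K * (nm (y - l) * nm l) <= K * (d * nm l).
  by rewrite ler_wpM2l// ler_wpM2r ?hnorm_ge0.
have : K * (d * nm l) + K * ((nm l + 1) * d) = M * d by rewrite /M; ring.
have := le_normcD (form r (y - l) l) (form r y (y - l)).
lra.
Qed.

Definition good (a : 'I_k -> R[i]) (rho : R) := forall p : 'I_k -> R[i],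
  (forall t, normc (p t - a t) <= rho) -> essential p.

Lemma good_shift a b rho rho' :
  (forall t, normc (b t - a t) <= rho - rho') -> good a rho -> good b rho'.
Proof.
move=> ab ga p pb; apply: ga => t.
have -> : p t - a t = (p t - b t) + (b t - a t) by rewrite addrA subrK.
by rewrite (le_trans (le_normcD _ _))//; have := ab t; have := pb t; lra.
Qed.

(* [mu] is a convex combination [\sum_n 3 / 4 ^ n.+1 *: lam n] of approximately
   attained values: the error made at each step is compensated in the next
   target [p], which the ball around [mu] leaves room for. *)
Lemma exact_value mu rho (V : seq H) : 0 < rho -> good mu rho ->
  exists y, [/\ nm y = 1, forall z, z \in V -> decoupled y z &
    forall t, ip (T t y) y = mu t].
Proof.
move=> rho0 gmu; pose q : R := 2^-1.
have q0 n : 0 < q ^+ n by rewrite exprn_gt0// invr_gt0.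
have qS n : q ^+ n.+1 = q ^+ n / 2 by rewrite exprSr.
(* The squared mass [(q ^+ n) ^+ 2] is still missing, and [s.2] is the average value it must have.
   The drift of [s.2] from [mu] stays strictly below [rho]. *)
pose P n (s : H * ('I_k -> R[i])) :=
  [/\ forall z, z \in V -> decoupled s.1 z,
      ip s.1 s.1 = (1 - (q ^+ n) ^+ 2)%:C,
      forall t, ip (T t s.1) s.1 = mu t - ((q ^+ n) ^+ 2)%:C * s.2 t &
      forall t, normc (s.2 t - mu t) <= rho * (1 - q ^+ n)].
pose Q n (s s' : H * ('I_k -> R[i])) := nm (s'.1 - s.1) <= q ^+ n.
have [|n [y p] [yV yy Ty pmu]|f fP] := @dependent_choice_seq _ P Q.
- exists (0, mu); split=> [z _|||] /=.
  + exact: decoupled0.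
  + by rewrite linear0l expr0 expr1n subrr.
  + by move=> t; rewrite linear0r expr0 expr1n mul1r subrr.
  + by move=> t; rewrite expr0 subrr normc0 subrr mulr0.
- have h0 := q0 n; set h := q ^+ n in h0 yy Ty pmu.
  have ep : essential p.
    apply: gmu => t; apply: le_trans (pmu t) _.
    by rewrite ler_piMr ?gerBl// ltW.
  (* Three times this error is [rho * h / 2], exactly the extra drift that the invariant grants when
     [h] is halved. *)
  have e0 : 0 < rho * h / 6 by rewrite divr_gt0// mulr_gt0.
  have [x [nx xV xl]] := essential_approx (y :: V) ep e0.
  pose c := Num.sqrt 3 / 2 * h.
  have s3 : Num.sqrt (3 : R) * Num.sqrt 3 = 3 by rewrite -expr2 sqr_sqrtr.
  have s32 : Num.sqrt (3 : R) <= 2 by have := sqrtr_ge0 (3 : R); nra.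
  have c2 : c * c = 3 / 4 * h ^+ 2.
    have -> : c * c = (Num.sqrt 3 * Num.sqrt 3) / 4 * h ^+ 2 by rewrite /c; field.
    by rewrite s3.
  have c0 : 0 <= c by rewrite mulr_ge0 ?divr_ge0 ?sqrtr_ge0// ltW.
  have xy : decoupled x y by apply: xV; rewrite inE eqxx.
  have yx := decoupledC xy.
  have xx : ip x x = 1 by rewrite -hnorm_sqr nx expr1n.
  have exp r : form r (y + c%:C *: x) (y + c%:C *: x) =
      form r y y + (c * c)%:C * form r x x.
    rewrite formDl !formDr !formZl !formZr xy yx !mulr0 addr0 add0r.
    by rewrite conjc_real mulrA -rmorphM.
  pose lam t := ip (T t x) x.
  (* Three quarters of the missing mass receive the value [lam], so the last quarter must average
     [4 p - 3 lam]. *)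
  exists (y + c%:C *: x, fun t => 4%:C * p t - 3%:C * lam t); split; last first.
    rewrite /Q /= addrC addKr hnormZ nx mulr1 normc_real ger0_norm//.
    by rewrite -/h /c; nra.
  split=> [z zV|||] /=.
  + rewrite addrC; apply: decoupledD; last exact: yV.
    by apply: decoupledZ; apply: xV; rewrite inE zV orbT.
  + have := exp None; rewrite /= => ->; rewrite yy xx mulr1 -rmorphD c2.
    by congr (_%:C); rewrite qS -/h; field.
  + move=> t; have := exp (Some (false, t)); rewrite /= => ->.
    rewrite Ty c2 -/(lam t) qS -/h.
    have -> : ((h / 2) ^+ 2)%:C = (h ^+ 2)%:C / 4%:C.
      by rewrite -fmorph_div; congr (_%:C); field.
    have -> : (3 / 4 * h ^+ 2)%:C = 3%:C / 4%:C * (h ^+ 2)%:C.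
      by rewrite -fmorph_div -rmorphM.
    rewrite /=.
    have n4 : 4%:C != 0 :> R[i] by rewrite fmorph_eq0 pnatr_eq0.
    by field.
  + move=> t; have -> : 4%:C * p t - 3%:C * lam t - mu t =
        (p t - mu t) - 3%:C * (lam t - p t).
      by rewrite !(rmorph_nat (real_complex R)); ring.
    rewrite (le_trans (le_normcD _ _))// normcN normcM normc_real ger0_norm// qS -/h.
    by have := xl t; rewrite -/(lam t); have := pmu t; nra.
have dist m n : (m <= n)%N -> nm ((f n).1 - (f m).1) <= 2 * q ^+ m - 2 * q ^+ n.
  move=> /subnKC <-; elim: (n - m)%N => [|d IH].
    by rewrite addn0 !subrr hnorm0.
  have := (fP (m + d)%N).2; rewrite /Q addnS qS => hd.
  have -> : (f (m + d).+1).1 - (f m).1 = ((f (m + d).+1).1 - (f (m + d)%N).1) +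
     ((f (m + d)%N).1 - (f m).1) by rewrite addrA subrK.
  by rewrite (le_trans (hnormD _ _ _))//; lra.
have [e e0|y yl] := complete (s := fun n => (f n).1).
  have [n0 h0] := half_lim (ler0n R 2) e0.
  exists n0 => m n m0 mn; apply: le_trans (dist m n mn) _.
  by have := h0 m m0; have := q0 n; rewrite -/q; lra.
have q2 n : (q ^+ n) ^+ 2 <= q ^+ n.
  by rewrite expr2 ger_pMl// exprn_ile1 ?invr_ge0// invf_le1//; lra.
exists y; split.
- have : ip y y = 1.
    apply: (@form_lim _ _ None) yl _ => e e0.
    have [n0 h0] := half_lim ler01 e0; exists n0 => n /h0; rewrite mul1r -/q => h.
    have [[_ yy _ _] _] := fP n; rewrite /= yy.
    rewrite -(rmorph1 (real_complex R)) -rmorphB normc_real addrAC subrr sub0r normrN.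
    by rewrite ger0_norm ?sqr_ge0// (le_trans (q2 n)).
  rewrite -hnorm_sqr => -[/eqP]; rewrite sqrf_eq1 => /orP[/eqP //|/eqP h].
  by have := hnorm_ge0 ip y; lra.
- move=> z zV r; apply: normc_lim0 => e e0.
  have d0 : 0 < K * nm z + 1 by rewrite ltr_wpDl// mulr_ge0// hnorm_ge0.
  have [n0 /(_ n0 (leqnn _)) h0] := yl (e / (K * nm z + 1)) (divr_gt0 e0 d0).
  have -> : form r y z = - form r ((f n0).1 - y) z.
    by rewrite formBl; have [[-> // _ _ _] _] := fP n0; rewrite sub0r opprK.
  rewrite normcN (le_trans (form_le _ _ _))// mulrCA.
  have : nm ((f n0).1 - y) * (K * nm z) <= e / (K * nm z + 1) * (K * nm z).
    by rewrite ler_wpM2r// mulr_ge0// hnorm_ge0.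
  move=> /le_trans; apply; rewrite mulrAC ler_pdivrMr//.
  by rewrite ler_pM2l//; lra.
- move=> t; apply: (@form_lim _ _ (Some (false, t))) yl _ => e e0.
  have B0 : 0 <= normc (mu t) + rho by rewrite addr_ge0 ?normc_ge0 ?ltW.
  have [n0 h0] := half_lim B0 e0; exists n0 => n /h0; rewrite -/q => h.
  have [[_ _ Ty pmu] _] := fP n.
  rewrite /= Ty addrAC subrr sub0r normcN normcM normc_real ger0_norm ?sqr_ge0//.
  have : normc ((f n).2 t) <= normc (mu t) + rho.
    rewrite -[(f n).2 t](subrK (mu t)) addrC (le_trans (le_normcD _ _))// lerD2l.
    by apply: le_trans (pmu t) _; rewrite ler_piMr ?gerBl// ltW.
  by have := q2 n; have := q0 n; have := normc_ge0 ((f n).2 t);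
    have := sqr_ge0 (q ^+ n); nra.
Qed.

(** Take decoupled unit vectors [x], [y] with values [a + e] and [a - e], and let [h], [d] be their
    normalised sum and difference. Diagonal values average to [a], mixed ones are half the
    difference, [e]. *)
Lemma pair_exists a rho (e : 'I_k -> R[i]) (V : seq H) : 0 < rho -> good a rho ->
  (forall t, normc (e t) <= rho / 2) ->
  exists h d, [/\ nm h = 1 /\ nm d = 1,
    forall z, z \in V -> decoupled h z /\ decoupled d z,
    ip d h = 0,
    forall t, ip (T t h) h = a t &
    forall t, ip (T t d) h = e t /\ ip d (T t h) = conjc (e t)].
Proof.
move=> rho0 ga eb.
have r2 : 0 < rho / 2 by rewrite divr_gt0.
have [x [nx xV Tx]] : exists x, [/\ nm x = 1, forall z, z \in V -> decoupled x z &
    forall t, ip (T t x) x = a t + e t].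
  apply: (exact_value V r2); apply: good_shift ga => t.
  by rewrite addrC addrA addNr add0r (le_trans (eb t))//; lra.
have [y [ny yV Ty]] : exists x', [/\ nm x' = 1,
    forall z, z \in x :: V -> decoupled x' z & forall t, ip (T t x') x' = a t - e t].
  apply: (exact_value (x :: V) r2); apply: good_shift ga => t.
  by rewrite addrAC subrr sub0r normcN (le_trans (eb t))//; lra.
have yx : decoupled y x by apply: yV; rewrite inE eqxx.
have xy := decoupledC yx.
pose c : R[i] := (Num.sqrt 2)^-1%:C.
have c2 : c * c = 2^-1%:C by rewrite -rmorphM sqrtrVK.
have cc : conjc c = c by rewrite conjc_real.
have xx : ip x x = 1 by rewrite -hnorm_sqr nx expr1n.
have yy : ip y y = 1 by rewrite -hnorm_sqr ny expr1n.
have h2 (z : R[i]) : 2^-1%:C * (z + z) = z.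
  rewrite mulrDr -mulrDl -rmorphD (_ : 2^-1 + 2^-1 = 1) ?mul1r//.
  by field.
have fh r : form r (c *: (x + y)) (c *: (x + y)) = 2^-1%:C * (form r x x + form r y y).
  by rewrite formZl formZr cc mulrA c2 formDl !formDr xy yx addr0 add0r.
have fd r : form r (c *: (x - y)) (c *: (x - y)) = 2^-1%:C * (form r x x + form r y y).
  by rewrite formZl formZr cc mulrA c2 formBl !formBr xy yx subr0 sub0r opprK.
have fdh r : form r (c *: (x - y)) (c *: (x + y)) = 2^-1%:C * (form r x x - form r y y).
  by rewrite formZl formZr cc mulrA c2 formBl !formDr xy yx addr0 add0r.
have nm1 z : ip z z = 1 -> nm z = 1.
  rewrite -hnorm_sqr => -[/eqP]; rewrite sqrf_eq1 => /orP[/eqP //|/eqP h].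
  by have := hnorm_ge0 ip z; lra.
exists (c *: (x + y)), (c *: (x - y)); split.
- by split; apply: nm1; [have := fh None|have := fd None]; rewrite /= => ->;
    rewrite xx yy h2.
- move=> z zV; have zV' : z \in x :: V by rewrite inE zV orbT.
  by split; apply: decoupledZ; [apply: decoupledD|apply: decoupledB]; auto.
- by have := fdh None; rewrite /= => ->; rewrite xx yy subrr mulr0.
- move=> t; have := fh (Some (false, t)); rewrite /= => ->; rewrite Tx Ty.
  by rewrite -[RHS]h2; congr (_ * _); ring.
- move=> t; split.
    have := fdh (Some (false, t)); rewrite /= => ->; rewrite Tx Ty.
    by rewrite -[RHS]h2; congr (_ * _); ring.
  have := fdh (Some (true, t)); rewrite /= => ->.
  rewrite (ipC _ _ x) (ipC _ _ y) Tx Ty -rmorphB /=.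
  by rewrite -[RHS]h2 -rmorphD; congr (_ * conjc _); ring.
Qed.

Lemma pairs_exist (J : eqType) (s : seq J) a rho (e : J -> 'I_k -> R[i])
    (V : seq H) : uniq s -> 0 < rho -> good a rho ->
  (forall j t, normc (e j t) <= rho / 2) ->
  exists h d : J -> H, forall j, j \in s -> [/\ nm (h j) = 1 /\ nm (d j) = 1,
    forall z, z \in V -> decoupled (h j) z /\ decoupled (d j) z,
    forall i, i \in s -> i != j -> decoupled (h i) (h j) /\ decoupled (d i) (h j),
    ip (d j) (h j) = 0 &
    forall t, [/\ ip (T t (h j)) (h j) = a t, ip (T t (d j)) (h j) = e j t &
      ip (d j) (T t (h j)) = conjc (e j t)]].
Proof.
move=> us rho0 ga eb; elim: s us => [_|j s IH /= /andP[js /IH [h [d hd]]]].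
  by exists (fun=> 0), (fun=> 0).
have [hj [dj [n1 hV o T1 T2]]] :=
  pair_exists (map h s ++ map d s ++ V) rho0 ga (eb j).
exists (fun i => if i == j then hj else h i), (fun i => if i == j then dj else d i).
have sj i : i \in s -> (i == j) = false.
  by move=> iS; apply/eqP => ij; move: js; rewrite -ij iS.
have jV i : i \in s -> [/\ decoupled hj (h i), decoupled dj (h i),
    decoupled hj (d i) & decoupled dj (d i)].
  by move=> iS; split; apply hV; rewrite !mem_cat map_f ?orbT.
move=> i; rewrite inE => /orP[/eqP -> |iS].
  rewrite eqxx; split=> // [z zV|i'|t]; last by split=> //; case: (T2 t).
    by apply: hV; rewrite !mem_cat zV !orbT.
  rewrite inE => /orP[/eqP -> /eqP //|iS' _]; rewrite sj//.
  by have [? ? ? ?] := jV _ iS'; split; apply: decoupledC.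
rewrite sj//; have [? ? oi ? ?] := hd i iS; split=> // i'.
rewrite inE => /orP[/eqP -> _|iS' ii']; last by rewrite sj//; apply: oi.
by rewrite eqxx; have [? ? ? ?] := jV _ iS.
Qed.
Hypothesis k_gt0 : (0 < k)%N.

Lemma hnorm1 x : ip x x = 1 -> nm x = 1.
Proof.
rewrite -hnorm_sqr => -[/eqP]; rewrite sqrf_eq1 => /orP[/eqP //|/eqP h].
by have := hnorm_ge0 ip x; lra.
Qed.

Lemma imag_sqr : 'i%C * 'i%C = -1 :> R[i].
Proof. by rewrite -expr2 sqr_i. Qed.

Lemma conj_imagM (x : R) : conjc ('i%C * x%:C) = - 'i%C * x%:C :> R[i].
Proof. by apply/eqP; rewrite eq_complex /=; apply/andP; split; apply/eqP; ring. Qed.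

Lemma normc_imag : normc ('i%C : R[i]) = 1.
Proof. by rewrite /= expr0n expr1n add0r sqrtr1. Qed.

(** The vector is the normalised sum of the first members of [2 * k] pairs, two per coordinate, with
    offsets [rho / 2] and [i * rho / 2]. An offset [e] shows up as [e] in [<T_t d, h>] and as its
    conjugate in [<d, T_t h>], so combining [d (t, false)] with [i] or [-i] times [d (t, true)]
    separates the two forms. The constant [C] is independent of [a] and [V]. *)
Lemma dual_block rho : 0 < rho -> exists C, 1 <= C /\
  forall a (V : seq H), good a rho -> exists h d, [/\ nm h = 1,
    forall z, z \in V -> decoupled h z /\ (forall r, decoupled (d r) z),
    forall t, ip (T t h) h = a t,
    forall p r, form p (d r) h = (p == r)%:R &
    forall r, nm (d r) <= C].
Proof.
move=> rho0; pose J : finType := ('I_k * bool)%type; pose n : R := #|{: J}|%:R.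
have n0 : 0 < n.
  by rewrite ltr0n card_prod card_ord card_bool muln_gt0 k_gt0.
pose c := (Num.sqrt n)^-1; have c0 : 0 < c by rewrite invr_gt0 sqrtr_gt0.
have c2 : c * c = n^-1 by apply: sqrtrVK.
pose kap := c * (rho / 2); have kap0 : 0 < kap by rewrite mulr_gt0// divr_gt0.
have C0 : 0 <= k%:R * (2 * (K * kap^-1)).
  by rewrite mulr_ge0// mulr_ge0// mulr_ge0// invr_ge0 ltW.
have kC : kap^-1 <= 1 + k%:R * (2 * (K * kap^-1)).
  have : 1 <= k%:R :> R by rewrite ler1n.
  have : 0 < kap^-1 by rewrite invr_gt0.
  have : kap^-1 <= K * kap^-1 by rewrite ler_peMl// invr_ge0 (ltW kap0).
  by have := K1; nra.
exists (1 + k%:R * (2 * (K * kap^-1))); split=> [|a V ga]; first by rewrite lerDl.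
pose e (j : J) u : R[i] :=
  if u == j.1 then (if j.2 then 'i%C else 1) * (rho / 2)%:C else 0.
have eb j t : normc (e j t) <= rho / 2.
  have r2 : 0 <= rho / 2 by rewrite divr_ge0// ltW.
  rewrite /e; case: ifP => _; last by rewrite normc0.
  rewrite normcM normc_real (ger0_norm r2).
  by case: j.2; rewrite ?normc_imag ?normc1 mul1r.
have [h [d hd]] := pairs_exist V (enum_uniq J) rho0 ga eb.
have {}hd j := hd j (mem_enum _ j).
have hh i j (ij : i != j) : decoupled (h i) (h j).
  by have [_ _ o _ _] := hd j; case: (o i (mem_enum _ i) ij).
have dh i j (ij : i != j) : decoupled (d i) (h j).
  by have [_ _ o _ _] := hd j; case: (o i (mem_enum _ i) ij).
pose g := c%:C *: \sum_j h j.
have fg r : form r g g = (n^-1)%:C * \sum_j form r (h j) (h j).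
  rewrite /g formZl formZr conjc_real mulrA -rmorphM c2; congr (_ * _).
  rewrite form_suml; apply: eq_bigr => i _.
  rewrite form_sumr (bigD1 i) //= big1 ?addr0// => j ji.
  by apply: hh; rewrite eq_sym.
have sumn (z : R[i]) : (n^-1)%:C * \sum_(j : J) z = z.
  rewrite sumr_const -mulr_natl mulrA -(rmorph_nat (real_complex R)) -rmorphM.
  by rewrite mulVf ?mul1r// gt_eqF.
have ng : nm g = 1.
  apply: hnorm1; have := fg None; rewrite /= => ->.
  rewrite -[RHS]sumn; congr (_ * _); apply: eq_bigr => j _.
  by have [[nh _] _ _ _ _] := hd j; rewrite -hnorm_sqr nh expr1n.
have Tg t : ip (T t g) g = a t.
  have := fg (Some (false, t)); rewrite /= => ->.
  rewrite -[RHS]sumn; congr (_ * _); apply: eq_bigr => j _.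
  by have [_ _ _ _ o] := hd j; case: (o t).
have fd r j : form r (d j) g = c%:C * form r (d j) (h j).
  rewrite formZr conjc_real form_sumr (bigD1 j) //= big1 ?addr0// => i ij.
  by apply: dh; rewrite eq_sym.
pose sg (b : bool) : R[i] := if b then 'i%C else - 'i%C.
pose D0 (b : bool) t := (2 * kap)^-1%:C *: (d (t, false) + sg b *: d (t, true)).
have D0n b t : form None (D0 b t) g = 0.
  rewrite formZl formDl formZl !fd /=.
  have [_ _ _ -> _] := hd (t, false); have [_ _ _ -> _] := hd (t, true).
  by rewrite !mulr0 addr0 mulr0.
have D0s b' u b t : form (Some (b', u)) (D0 b t) g = ((b', u) == (b, t))%:R.
  have krho : (2 * kap)^-1 * (c * (rho / 2)) = 2^-1.
    by rewrite -/kap; field; rewrite gt_eqF.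
  have h2 : 2^-1%:C = 2^-1 :> R[i] by rewrite fmorphV /= (rmorph_nat (real_complex R)).
  have cM (x y : R) : (x * y)%:C = x%:C * y%:C by apply: rmorphM.
  rewrite formZl formDl formZl !fd.
  have [_ _ _ _ /(_ u) [_ e1 e2]] := hd (t, false).
  have [_ _ _ _ /(_ u) [_ e3 e4]] := hd (t, true).
  rewrite xpair_eqE; case: b' => /=; rewrite ?e1 ?e2 ?e3 ?e4 /e /=;
    have [_|_] := eqVneq u t; rewrite ?andbF ?conjc0 ?mulr0 ?addr0 ?mulr0// andbT.
    rewrite mul1r conj_imagM conjc_real.
    transitivity (((2 * kap)^-1 * (c * (rho / 2)))%:C * (1 - sg b * 'i%C)).
      by rewrite [in RHS]cM [in RHS]cM; ring.
    rewrite krho h2 /sg; case: b => /=; rewrite ?mulNr imag_sqr ?opprK.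
      by field.
    by rewrite addrN mulr0.
  transitivity (((2 * kap)^-1 * (c * (rho / 2)))%:C * (1 + sg b * 'i%C)).
    by rewrite [in RHS]cM [in RHS]cM; ring.
  rewrite krho h2 /sg; case: b => /=; rewrite ?mulNr imag_sqr ?opprK.
    by rewrite addrN mulr0.
  by field.
have D0V b t z : z \in V -> decoupled (D0 b t) z.
  move=> zV; apply: decoupledZ; apply: decoupledD; last apply: decoupledZ.
    by have [_ o _ _ _] := hd (t, false); case: (o z zV).
  by have [_ o _ _ _] := hd (t, true); case: (o z zV).
have D0le b t : nm (D0 b t) <= kap^-1.
  rewrite hnormZ normc_real ger0_norm; last by rewrite invr_ge0 mulr_ge0// (ltW kap0).
  rewrite invfM mulrAC -[X in _ <= X]mul1r ler_wpM2r ?invr_ge0 ?(ltW kap0)//.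
  rewrite mulrC ler_pdivrMr// mul1r (le_trans (hnormD _ _ _))// hnormZ.
  have [[_ ->] _ _ _ _] := hd (t, false); have [[_ ->] _ _ _ _] := hd (t, true).
  by rewrite /sg; case: b; rewrite ?normcN normc_imag mulr1.
(* [a t] is a value on a unit vector, which bounds it without any further hypothesis. *)
have ak t : normc (a t) <= K.
  by rewrite -Tg (le_trans (form_le (Some (false, t)) _ _))// ng !mulr1.
clearbody D0.
have DS b u t : form (Some (b, u)) (a t *: D0 false t + conjc (a t) *: D0 true t) g =
    if t == u then if b then conjc (a t) else a t else 0.
  rewrite formDl !formZl !D0s !xpair_eqE (eq_sym u).
  rewrite eqbF_neg eqb_id.
  by case: (t == u); case: b; rewrite /= ?mulr1 ?mulr0 ?addr0 ?add0r.
(* The dual for the plain inner product is [g] itself, freed of its values [a t] and [conjc (a t)]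
   under the other forms. *)
pose D (r : option (bool * 'I_k)) := if r is Some (b, t) then D0 b t else
  g - \sum_t (a t *: D0 false t + conjc (a t) *: D0 true t).
have gV z : z \in V -> decoupled g z.
  move=> zV; apply: decoupledZ; apply: decoupled_sum => j _.
  by have [_ o _ _ _] := hd j; case: (o z zV).
exists g, D; split=> //.
- move=> z zV; split; first exact: gV.
  case=> [[b t]|] /=; first exact: D0V.
  apply: decoupledB; first exact: gV.
  by apply: decoupled_sum => t _; apply: decoupledD; apply: decoupledZ; apply: D0V.
- move=> p [[b t]|]; last first.
    rewrite /D formBl form_suml.
    case: p => [[b u]|].
      under eq_bigr do rewrite DS.
      rewrite -big_mkcond big_pred1_eq.
      by case: b; rewrite /= ?(ipC _ (T u g)) Tg subrr.
    rewrite big1 ?subr0 => [|t _]; last by rewrite formDl !formZl !D0n !mulr0 addr0.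
    by rewrite /= -hnorm_sqr ng expr1n.
  case: p => [[b' u]|]; last exact: D0n.
  by rewrite D0s; congr (_%:R); congr nat_of_bool; apply/eqP/eqP => [->|[-> ->]].
- case=> [[b t]|] /=; first exact: le_trans kC.
  rewrite (le_trans (hnormD _ _ _))// ng lerD2l hnormN (le_trans (hnorm_sum _ _ _ _))//.
  rewrite -[X in X%:R * _](card_ord k) mulr_natl -sumr_const; apply: ler_sum => t _.
  rewrite (le_trans (hnormD _ _ _))// !hnormZ normc_conj.
  have := ak t; have := D0le false t; have := D0le true t.
  have := hnorm_ge0 ip (D0 false t); have := hnorm_ge0 ip (D0 true t).
  have := normc_ge0 (a t); have : 0 < kap^-1 by rewrite invr_gt0.
  by have := K1; nra.
Qed.

(** [u = z + al h + be y]: the dual block [h] gets squared mass [s], and [y] gets the rest of the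
    unit mass together with the value [mu] that brings the total to [a]. Since [z] and [h] are
    small, [mu] is within [rho / 2] of [a] and [exact_value] applies. The duals only pay the fixed
    factor [1 / al]. *)
Lemma extension rho : 0 < rho -> exists sC : R * R, [/\ 0 < sC.1, 1 <= sC.2 &
  forall a z (V : seq H), good a rho -> nm z ^+ 2 <= sC.1 -> exists u d,
    [/\ nm u = 1, forall t, ip (T t u) u = a t,
      forall x, x \in V -> decoupled (u - z) x /\ (forall r, decoupled (d r) x),
      forall p r, form p (d r) u = (p == r)%:R &
      forall r, nm (d r) <= sC.2]].
Proof.
move=> rho0; have [C [C1 blk]] := dual_block rho0.
have den : 0 < 8 * K + 4 * rho by have := K1; lra.
pose s := rho / (8 * K + 4 * rho); have s0 : 0 < s by rewrite divr_gt0.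
(* This keeps the mass [bb] of [y] above 1/2. The next line bounds the displacement of [mu], at most
   [2 * K * s / bb]. *)
have s4 : s <= 4^-1 by rewrite ler_pdivrMr//; have := K1; lra.
have sK : 4 * K * s <= rho / 2 by rewrite mulrA ler_pdivrMr//; nra.
pose al := Num.sqrt s; have al0 : 0 < al by rewrite sqrtr_gt0.
have al2 : al ^+ 2 = s by rewrite sqr_sqrtr// ltW.
have al1 : al <= 1 by nra.
have alV : 1 <= al^-1 by rewrite invf_ge1.
exists (s, C / al); split=> [//||a z V ga zs] /=.
  by rewrite mulr_ege1.
have {}zs : nm z ^+ 2 <= s := zs.
have [h [d [nh hV Th dh dC]]] := blk a (z :: V) ga.
have nz2 := sqr_ge0 (nm z).
pose bb := 1 - nm z ^+ 2 - s; have bb0 : 2^-1 <= bb by rewrite /bb; lra.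
have bbp : 0 < bb by lra.
pose be := Num.sqrt bb; have be2 : be ^+ 2 = bb by rewrite sqr_sqrtr// ltW.
have be0 : 0 < be by rewrite sqrtr_gt0.
have bbC : bb%:C != 0 by rewrite fmorph_eq0 gt_eqF.
pose mu t : R[i] := (a t - ip (T t z) z - s%:C * a t) / bb%:C.
have r2 : 0 < rho / 2 by rewrite divr_gt0.
have ak t : normc (a t) <= K.
  by rewrite -Th (le_trans (form_le (Some (false, t)) _ _))// nh !mulr1.
have [y [ny yV Ty]] : exists y, [/\ nm y = 1, forall x, x \in h :: z :: V ++
    [seq d r | r <- enum {: option (bool * 'I_k)}] -> decoupled y x &
    forall t, ip (T t y) y = mu t].
  apply: (exact_value _ r2); apply: good_shift ga => t.
  have -> : mu t - a t = ((nm z ^+ 2)%:C * a t - ip (T t z) z) / bb%:C.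
    have -> : (nm z ^+ 2)%:C = 1 - s%:C - bb%:C.
      by rewrite -(rmorph1 (real_complex R)) -!rmorphB; congr (_%:C); rewrite /bb; ring.
    by rewrite /mu; field.
  have bbi : (0 <= bb^-1 <= 2).
    by rewrite invr_ge0 ltW //= -[2]invrK lef_pV2 ?posrE ?invr_gt0.
  rewrite normcM normcV normc_real (ger0_norm (ltW bbp)).
  have nn : normc ((nm z ^+ 2)%:C * a t - ip (T t z) z) <= 2 * K * s.
    rewrite (le_trans (le_normcD _ _))// normcN normcM normc_real ger0_norm//.
    have := form_le (Some (false, t)) z z; rewrite /= -expr2.
    by have := ak t; have := normc_ge0 (a t); nra.
  have := normc_ge0 ((nm z ^+ 2)%:C * a t - ip (T t z) z).
  by case/andP: bbi => b1 b2; nra.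
have hz : decoupled h z by apply hV; rewrite inE eqxx.
have zh := decoupledC hz.
have yh : decoupled y h by apply: yV; rewrite inE eqxx.
have hy := decoupledC yh.
have yz : decoupled y z by apply: yV; rewrite !inE eqxx orbT.
have zy := decoupledC yz.
have dz r : decoupled (d r) z by apply hV; rewrite inE eqxx.
have dy r : decoupled (d r) y.
  apply: decoupledC; apply: yV; rewrite !inE mem_cat map_f ?orbT// mem_enum//.
pose u := z + (al%:C *: h + be%:C *: y).
have fu r : form r u u = form r z z + s%:C * form r h h + bb%:C * form r y y.
  rewrite /u !(formDl, formDr, formZl, formZr) zh zy hz hy yz yh !mulr0 !addr0 !add0r.
  by rewrite !conjc_real !mulrA -!rmorphM -!expr2 al2 be2 addrA.
have hh : ip h h = 1 by rewrite -hnorm_sqr nh expr1n.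
have yy : ip y y = 1 by rewrite -hnorm_sqr ny expr1n.
exists u, (fun r => al^-1%:C *: d r); split.
- apply: hnorm1; have := fu None; rewrite /= => ->; rewrite hh yy !mulr1.
  by rewrite -hnorm_sqr -!rmorphD -(rmorph1 (real_complex R)); congr (_%:C); rewrite /bb; ring.
- move=> t; have := fu (Some (false, t)); rewrite /= => ->; rewrite Th Ty /mu.
  by field.
- move=> x xV; split; last first.
    by move=> r; apply: decoupledZ; apply hV; rewrite inE xV orbT.
  rewrite /u addrC addKr; apply: decoupledD; apply: decoupledZ.
    by apply hV; rewrite inE xV orbT.
  by apply: yV; rewrite !inE mem_cat xV !orbT.
- move=> p r; rewrite /u formZl !(formDr, formZr) dz dy dh !mulr0 addr0 add0r.
  by rewrite conjc_real mulrA -rmorphM mulVf ?mul1r// gt_eqF.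
- move=> r; rewrite hnormZ normc_real ger0_norm ?invr_ge0 ?(ltW al0)// mulrC.
  by rewrite ler_wpM2r// invr_ge0 (ltW al0).
Qed.

End Construction.

(** * The potential of a weighted Gram bound *)

Section Potential.
Variable R : realType.
Implicit Types (W f g x : nat -> R) (G : nat -> nat -> R) (A C : R).

(** Bounds the coefficients along the new block: old duals are corrected by at most [x l], while
    each new dual is a block vector with coefficient 1. *)
Definition extend1 n x l : R := if (l < n)%N then x l else 1.

Definition upd n C x G l m : R :=
  (if (l < n)%N && (m < n)%N then G l m else 0) +
  C * (extend1 n x l * extend1 n x m).

(* The row sums of [G] are weighted by [W]; [f m] is what remains of the column
   sum of [m], so that the growth of [G] is paid for by the decrease of [f]. *)
Definition pot A W f G n l : R := W l * \sum_(m < n) G l m * (W m + A * f m).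

(** The rank-one term adds [W l * C * x l * S] to the potential of row [l]. As [A * g <= W], the old
    indices contribute at most [2 * 4^-1] to [S] and the new one at most 2, so [S <= 3]. *)
Lemma pot_upd A C W g x G n :
  0 <= A -> 0 <= C -> (forall j, (j < n)%N -> 0 <= x j) -> (forall j, 0 < W j <= 1) ->
  (forall j, (j <= n)%N -> 0 <= A * g j <= W j) -> W n = 1 ->
  \sum_(j < n) x j * W j <= 4^-1 ->
  (forall l, (l < n)%N ->
    pot A W g (upd n C x G) n.+1 l <= pot A W g G n l + 3 * C * (W l * x l)) /\
  pot A W g (upd n C x G) n.+1 n <= 3 * C.
Proof.
move=> A0 C0 x0 W01 Ag Wn xW.
pose S := \sum_(m < n.+1) extend1 n x m * (W m + A * g m).
have S3 : S <= 3.
  rewrite /S big_ord_recr /= {2}/extend1 ltnn mul1r Wn.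
  have : \sum_(i < n) extend1 n x i * (W i + A * g i) <= \sum_(j < n) 2 * (x j * W j).
    apply: ler_sum => j _; rewrite /extend1 ltn_ord mulrCA ler_wpM2l ?x0//.
    by have := Ag j (ltnW (ltn_ord j)) => /andP[_]; lra.
  rewrite -mulr_sumr; have := Ag n (leqnn n); rewrite Wn => /andP[_]; lra.
have e l : pot A W g (upd n C x G) n.+1 l =
    (if (l < n)%N then pot A W g G n l else 0) + W l * (C * (extend1 n x l * S)).
  rewrite /pot /upd; under eq_bigr do rewrite mulrDl.
  rewrite big_split /= mulrDr; congr (_ + _).
    rewrite big_ord_recr /= ltnn andbF mul0r addr0.
    case: ifP => ln; last by rewrite big1 ?mulr0// => i _; rewrite mul0r.
    by congr (_ * _); apply: eq_bigr => i _; rewrite ltn_ord.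
  rewrite /S !mulr_sumr; apply: eq_bigr => i _; ring.
split=> [l ln|].
  rewrite e ln lerD2l /extend1 ln; have /andP[/ltW Wl _] := W01 l.
  rewrite [leRHS](_ : _ = W l * (C * (x l * 3))); last by ring.
  by rewrite ler_wpM2l// ler_wpM2l// ler_wpM2l// x0.
rewrite e ltnn add0r Wn mul1r /extend1 ltnn mul1r mulrC ler_wpM2r//.
Qed.

End Potential.

(** * One step of the recursion and its effect on the Gram bound *)

Section Recursion.
Variables (R : realType) (H : lmodType R[i]) (ip : {dot H for Num.conj}).
Variables (k : nat) (T : 'I_k -> {linear H -> H}).
Variable K : R.
Hypothesis K1 : 1 <= K.
Hypothesis TK : forall t x, hnorm ip (T t x) <= K * hnorm ip x.

Local Notation nm := (hnorm ip).
Local Notation form := (form ip T).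
Local Notation decoupled := (decoupled ip T).
Local Notation form_le := (form_le K1 TK).
Local Notation good := (good ip T).
Local Notation idx := (option (bool * 'I_k)).

Let K0 : 0 <= K. Proof. by rewrite (le_trans ler01). Qed.

Variables (rho s C : R).
Hypothesis s0 : 0 < s.
Hypothesis C1 : 1 <= C.
Hypothesis extend : forall a z (V : seq H), good a rho -> nm z ^+ 2 <= s ->
  exists u d, [/\ nm u = 1, forall t, ip (T t u) u = a t,
    forall x, x \in V -> decoupled (u - z) x /\ (forall r, decoupled (d r) x),
    forall p r, form p (d r) u = (p == r)%:R &
    forall r, nm (d r) <= C].

Variables (B : nat -> nat -> Prop) (a : nat -> nat -> 'I_k -> R[i]).
Hypothesis good_diag : forall n, good (a n n) rho.

Definition nforms : R := #|{: idx}|%:R.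
Local Notation mm := nforms.

Lemma nforms_ge1 : 1 <= mm.
Proof. by rewrite ler1n; apply/card_gt0P; exists None. Qed.

Let mm0 : 0 <= mm. Proof. by rewrite (le_trans ler01)// nforms_ge1. Qed.

(** A correction uses [mm] block vectors of norm at most [C]; two corrections meet in [mm ^+ 2]
    pairs, each at most [K * C ^+ 2]. *)
Definition growth : R := mm ^+ 2 * (K * C ^+ 2).

Lemma growth_ge1 : 1 <= growth.
Proof.
by rewrite mulr_ege1 ?exprn_ege1 ?nforms_ge1// mulr_ege1// exprn_ege1.
Qed.

(** [G] is only a majorant of the forms between duals, so that its update can be given by an exact
    formula. *)
Definition invariant n (u : nat -> H) (D : nat -> idx -> H)
    (G : nat -> nat -> R) : Prop :=
  [/\ forall i j, (i < n)%N -> (j < n)%N -> ip (u i) (u j) = (i == j)%:R,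
      forall i j t, (i < n)%N -> (j < n)%N -> B i j \/ i = j ->
        ip (T t (u j)) (u i) = a i j t,
      forall l i p r, (l < n)%N -> (i < n)%N ->
        form p (D l r) (u i) = ((l == i) && (p == r))%:R,
      forall l m p r r', (l < n)%N -> (m < n)%N ->
        normc (form p (D l r) (D m r')) <= G l m &
      forall l m, (l < n)%N -> (m < n)%N -> G l m = G m l].

(** All earlier vectors and duals enter the list from which [u' n - z] and the new block are
    decoupled. So [z] alone decides how [u' n] meets them, and correcting an old dual along the
    block leaves its values at old vectors intact. *)
Lemma invariant_step n u D G z x (V : seq H) : invariant n u D G ->
  nm z ^+ 2 <= s ->
  (forall i, (i < n)%N -> ip z (u i) = 0) ->
  (forall i t, (i < n)%N -> B n i -> ip (T t (u i)) z = a n i t) ->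
  (forall i t, (i < n)%N -> B i n -> ip (T t z) (u i) = a i n t) ->
  (forall l p r, (l < n)%N -> normc (form p (D l r) z) <= x l) ->
  exists u' D', [/\ invariant n.+1 u' D' (upd n growth x G),
    forall i, (i < n)%N -> u' i = u i &
    forall y, y \in V -> [/\ decoupled (u' n - z) y,
      forall r, decoupled (D' n r) y &
      forall l r, (l < n)%N -> decoupled (D l r) y -> decoupled (D' l r) y]].
Proof.
move=> [uo uB Du DG Gs] zs zu zB zB' xD.
pose V0 := z :: V ++ [seq u i | i <- iota 0 n] ++
  [seq D l r | l <- iota 0 n, r <- enum {: idx}].
have [v [d [nv Tv vV dv dC]]] := extend V0 (@good_diag n) zs.
have in_u i : (i < n)%N -> u i \in V0.
  by move=> lt; rewrite inE !mem_cat map_f ?orbT// mem_iota.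
have in_D l r : (l < n)%N -> D l r \in V0.
  move=> lt; rewrite inE !mem_cat; apply/orP; right; apply/orP; right.
  by apply/orP; right; apply/allpairsP; exists (l, r); rewrite mem_iota lt mem_enum.
have in_V y : y \in V -> y \in V0.
  by move=> yV; rewrite inE mem_cat yV orbT.
pose e := v - z; have vE : v = z + e by rewrite /e addrC subrK.
have eV y : y \in V0 -> decoupled e y by move=> /vV[].
have dV y r : y \in V0 -> decoupled (d r) y by move=> /vV[].
have Vd y r : y \in V0 -> decoupled y (d r) by move=> yV; apply/decoupledC/dV.
have fvr p y : y \in V0 -> form p y v = form p y z.
  by move=> yV; rewrite vE formDr (decoupledC (eV _ yV)) addr0.
have fvl p y : y \in V0 -> form p v y = form p z y.
  by move=> yV; rewrite vE formDl (eV _ yV) addr0.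
pose u' i := if (i < n)%N then u i else v.
pose E l r := if (l < n)%N then D l r else 0.
(* For an old index this cancels the value on the new vector; at [n] it selects [d r]. *)
pose c l r q := if (l < n)%N then - form q (D l r) z else (q == r)%:R.
pose D' l r := E l r + \sum_q c l r q *: d q.
have EV l r q : decoupled (d q) (E l r).
  by rewrite /E; case: ifP => [lt|_]; [apply/dV/in_D|apply/decoupledC/decoupled0].
have cx l r q : normc (c l r q) <= extend1 n x l.
  rewrite /c /extend1; case: ifP => ln; first by rewrite normcN xD.
  by case: (q == r); rewrite ?normc0 ?normc1.
have Du' l i p r : (l < n.+1)%N -> (i < n.+1)%N ->
    form p (D' l r) (u' i) = ((l == i) && (p == r))%:R.
  rewrite /D' formDl form_suml /u' !ltnS => ln; rewrite leq_eqVlt => /orP[/eqP ->|lt].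
    rewrite ltnn (bigD1 p)//= big1 ?addr0; last first.
      by move=> q qp; rewrite formZl dv eq_sym (negPf qp) mulr0.
    rewrite formZl dv eqxx mulr1 /E /c.
    case: (ltnP l n) => [lt|ge]; first by rewrite fvr ?in_D// addrN ltn_eqF.
    by rewrite form0l add0r eqn_leq ln ge.
  rewrite lt big1 ?addr0; last by move=> q _; rewrite formZl (dV _ _ (in_u _ lt)) mulr0.
  rewrite /E; case: (ltnP l n) => [lt'|ge]; first exact: Du.
  by rewrite form0l gtn_eqF// (leq_trans lt).
have nD l : (l < n.+1)%N -> 0 <= extend1 n x l.
  move=> _; apply: le_trans (cx l None None); exact: normc_ge0.
have leS i : (i < n.+1)%N -> (i == n) || (i < n)%N by rewrite ltnS leq_eqVlt.
exists u', D'; split; first split.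
- move=> i j /leS/orP[/eqP ->|lti] /leS/orP[/eqP ->|ltj]; rewrite /u' ?ltnn ?lti ?ltj ?eqxx.
  + by rewrite -hnorm_sqr nv expr1n.
  + have := fvl None _ (in_u _ ltj); rewrite /= => ->.
    by rewrite zu// gtn_eqF.
  + rewrite ipC; have := fvl None _ (in_u _ lti); rewrite /= => ->.
    by rewrite zu// conjc0 ltn_eqF.
  + exact: uo.
- move=> i j t /leS/orP[/eqP ->|lti] /leS/orP[/eqP ->|ltj]; rewrite /u' ?ltnn ?lti ?ltj ?eqxx.
  + by move=> _; apply: Tv.
  + have := fvr (Some (false, t)) _ (in_u _ ltj); rewrite /= => -> [/zB -> //|nj].
    by move: ltj; rewrite nj ltnn.
  + have := fvl (Some (false, t)) _ (in_u _ lti); rewrite /= => -> [/zB' -> //|nj].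
    by move: lti; rewrite nj ltnn.
  + exact: uB.
- by move=> *; apply: Du'.
- move=> l m p r r' ln mn; rewrite /D' formDl !formDr.
  have -> : form p (E l r) (\sum_q c m r' q *: d q) = 0.
    by rewrite form_sumr big1// => q _; rewrite formZr (decoupledC (EV _ _ _)) mulr0.
  have -> : form p (\sum_q c l r q *: d q) (E m r') = 0.
    by rewrite form_suml big1// => q _; rewrite formZl EV mulr0.
  rewrite addr0 add0r (le_trans (le_normcD _ _))// /upd lerD//.
    rewrite /E; case: (ltnP l n) => l'; last by rewrite form0l normc0.
    by case: (ltnP m n) => m'; rewrite ?form0r ?normc0//=; apply: DG.
  rewrite form_suml (le_trans (normc_sum _ _ _))//.
  apply: (@le_trans _ _ (\sum_(q : idx) \sum_(q' : idx)
      (extend1 n x l * extend1 n x m) * (K * C ^+ 2))).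
    apply: ler_sum => q _; rewrite formZl form_sumr mulr_sumr.
    rewrite (le_trans (normc_sum _ _ _))//; apply: ler_sum => q' _.
    rewrite formZr mulrA normcM normcM normc_conj; apply: ler_pM => //.
    - by rewrite mulr_ge0 ?normc_ge0.
    - exact: normc_ge0.
    - by rewrite ler_pM ?normc_ge0.
    rewrite (le_trans (form_le _ _ _))// ler_wpM2l// expr2.
    by rewrite ler_pM ?hnorm_ge0.
  rewrite !sumr_const -mulrnA -[_ *+ _]mulr_natl natrM -/mm /growth.
  by rewrite le_eqVlt; apply/orP; left; apply/eqP; ring.
- move=> l m ln mn; rewrite /upd andbC [extend1 n x l * _]mulrC.
  by case: andP => // -[m' l']; rewrite Gs.
- by move=> i lt; rewrite /u' lt.
- move=> y /in_V yV; split.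
  + by rewrite /u' ltnn; apply: eV.
  + move=> r; rewrite /D' /E ltnn add0r; apply: decoupled_sum => q _.
    by apply: decoupledZ; apply: dV.
  + move=> l r lt h; rewrite /D' /E lt; apply: decoupledD => //.
    by apply: decoupled_sum => q _; apply: decoupledZ; apply: dV.
Qed.

Variable b : nat -> nat -> R.
Hypothesis b0 : forall n l, 0 <= b n l.
Hypothesis ab : forall n l t, B n l -> normc (a n l t) <= b n l.
Hypothesis ab' : forall n l t, B l n -> normc (a l n t) <= b n l.

(** Biorthogonality turns the conditions into coefficients: [w] is the combination of duals with
    coefficients [tau], and [G] bounds its norm. The list [V] serves to track correlations with a
    fixed vector. *)
Lemma regular_step n u D G (V : seq H) : invariant n u D G ->
  mm ^+ 2 * (\sum_(l < n) \sum_(m < n) b n l * b n m * G l m) <= s ->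
  exists u' D',
    [/\ invariant n.+1 u' D' (upd n growth (fun l => mm * \sum_(j < n) b n j * G l j) G),
      forall i, (i < n)%N -> u' i = u i &
      forall y, y \in V -> [/\ forall r, decoupled (D' n r) y,
        forall l r, (l < n)%N -> decoupled (D l r) y -> decoupled (D' l r) y &
        normc (ip (u' n) y) <= \sum_(l < n) \sum_(r : idx) b n l * normc (ip (D l r) y)]].
Proof.
move=> inv bs; have [uo uB Du DG Gs] := inv.
(* [None] gets 0 for orthogonality; entries outside [B] are free and set to 0. The conjugate appears
   because the new vector [w] sits in the first slot of [form]. *)
pose tau l (r : idx) : R[i] := match r with
  | None => 0
  | Some (false, t) => if `[< B l n >] then a l n t else 0
  | Some (true, t) => if `[< B n l >] then conjc (a n l t) else 0
  end.
have tb l r : normc (tau l r) <= b n l.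
  rewrite /tau; case: r => [[[] t]|]; rewrite ?normc0//; case: asboolP => h;
    by rewrite ?normc_conj ?normc0// ?ab// ab'.
pose w := \sum_(l < n) \sum_r tau l r *: D l r.
have wu i p : (i < n)%N -> form p w (u i) = tau i p.
  move=> lt; rewrite /w form_suml (bigD1 (Ordinal lt))//= [X in _ + X]big1 ?addr0; last first.
    move=> l li; rewrite form_suml big1// => r _.
    by rewrite formZl Du// (negPf (li : (l : nat) != i)) mulr0.
  rewrite form_suml (bigD1 p)//= big1 ?addr0; last first.
    by move=> r rp; rewrite formZl Du// (eq_sym p) (negPf rp) andbF mulr0.
  by rewrite formZl Du// !eqxx mulr1.
have sumK (x : R) : \sum_(r : idx) x = mm * x by rewrite sumr_const mulr_natl.
have nw : nm w ^+ 2 <= s.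
  have -> : nm w ^+ 2 = normc (form None w w) by rewrite /= -hnorm_sqr normc_real ger0_norm ?sqr_ge0.
  apply: le_trans bs; rewrite {1}/w form_suml (le_trans (normc_sum _ _ _))// mulr_sumr.
  apply: ler_sum => l _; rewrite form_suml (le_trans (normc_sum _ _ _))//.
  have -> : mm ^+ 2 * (\sum_(m < n) b n l * b n m * G l m) =
      \sum_(r : idx) b n l * \sum_(m < n) mm * (b n m * G l m).
    by rewrite sumK !mulr_sumr; apply: eq_bigr => m _; ring.
  apply: ler_sum => r _; rewrite formZl normcM {1}/w form_sumr.
  apply: ler_pM; rewrite ?normc_ge0// (le_trans (normc_sum _ _ _))//.
  apply: ler_sum => m _; rewrite form_sumr (le_trans (normc_sum _ _ _))// -sumK.
  apply: ler_sum => r' _; rewrite formZr normcM normc_conj.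
  by rewrite ler_pM ?normc_ge0// DG.
have xD l p r : (l < n)%N ->
    normc (form p (D l r) w) <= mm * \sum_(j < n) b n j * G l j.
  move=> lt; rewrite /w form_sumr (le_trans (normc_sum _ _ _))// mulr_sumr.
  apply: ler_sum => m _; rewrite form_sumr (le_trans (normc_sum _ _ _))// -sumK.
  apply: ler_sum => r' _; rewrite formZr normcM normc_conj.
  by rewrite ler_pM ?normc_ge0// DG.
have [|i t lt nB|i t lt nB|u' [D' [inv' uu VV]]] :=
  @invariant_step n u D G w _ V inv nw _ _ _ xD.
- by move=> i lt; have := wu i None lt.
- have := wu i (Some (true, t)) lt; rewrite /= asboolT// => h.
  by rewrite ipC h conjcK.
- by have := wu i (Some (false, t)) lt; rewrite /= asboolT.
exists u', D'; split=> // y yV; have [vy dy Dy] := VV y yV; split=> //.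
have -> : ip (u' n) y = form None w y.
  by rewrite -[LHS]/(form None _ _) -[u' n](subrK w) formDl vy add0r.
rewrite /w form_suml (le_trans (normc_sum _ _ _))//; apply: ler_sum => l _.
rewrite form_suml (le_trans (normc_sum _ _ _))//; apply: ler_sum => r _.
by rewrite formZl normcM ler_wpM2r ?normc_ge0.
Qed.

(** At a free index orthogonality is the only condition left, and the residual satisfies it. The
    factor [sqrt s] meets the norm threshold, and decoupling [u' n - z] from the residual leaves
    only [z] in the inner product with [g]. *)
Lemma absorb_step n u D G g x : invariant n u D G -> nm g <= 1 ->
  (forall i, (i < n)%N -> ~ B n i /\ ~ B i n) ->
  (forall l p r, (l < n)%N ->
    normc (form p (D l r) ((Num.sqrt s)%:C *: residual ip n u g)) <= x l) ->
  exists u' D', [/\ invariant n.+1 u' D' (upd n growth x G),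
    forall i, (i < n)%N -> u' i = u i &
    ip g (u' n) = (Num.sqrt s * nm (residual ip n u g) ^+ 2)%:C].
Proof.
move=> inv g1 nB xD; have [uo uB Du DG Gs] := inv.
set r := residual ip n u g; set z := (Num.sqrt s)%:C *: r in xD *.
have ss : 0 <= Num.sqrt s by apply: sqrtr_ge0.
have nz : nm z ^+ 2 <= s.
  rewrite hnormZ normc_real ger0_norm// exprMn sqr_sqrtr ?(ltW s0)//.
  rewrite ger_pMr// exprn_ile1 ?hnorm_ge0//.
  exact: le_trans (residual_norm g uo) g1.
have [i lt|i t lt /(nB i lt).1|i t lt /(nB i lt).2|u' [D' [inv' uu VV]]] //:=
  @invariant_step n u D G z x [:: r] inv nz _ _ _ xD.
  by rewrite ipZl residual_ortho ?mulr0.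
exists u', D'; split=> //; have [vr _ _] := VV r (mem_head _ _).
have [uo' _ _ _ _] := inv'.
rewrite -[g](subrK (\sum_(i < n) ip g (u i) *: u i)) -/(residual ip n u g) -/r.
rewrite -[LHS]/(form None _ _) formDl form_suml [X in _ + X]big1 ?addr0; last first.
  move=> i _; rewrite formZl /= -(uu i)// uo'// ?ltnS ?(ltnW (ltn_ord i))//.
  by rewrite ltn_eqF// mulr0.
rewrite -[u' n](subrK z) formDr (decoupledC vr) add0r formZr conjc_real /=.
by rewrite -hnorm_sqr -rmorphM.
Qed.

(** * Weights and potential along the whole construction *)

Hypothesis s1 : s <= 1.
Hypothesis free : forall N, exists2 n, (N <= n)%N &
  forall i, (i < n)%N -> ~ B n i /\ ~ B i n.
Hypothesis bC : forall n l, b n l = b l n.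

(** [cA] is the price per unit of column sum: [3 * growth] from [pot_upd] times the [mm] in the [x]
    of [regular_step]. [Q0] is the bound of [pot_upd] for a new row. *)
Let cA : R := 3 * mm * growth.
Let Q0 : R := 3 * growth.

Variable del : R.
Hypothesis del0 : 0 < del.
Hypothesis delA : 3 * mm * growth * del <= 1.
Hypothesis delQ : mm * (del * (2 * (3 * growth))) <= 4^-1.
Hypothesis delS : mm ^+ 2 * (del * (del * (2 * (3 * growth)))) <= s.

Variable F : nat -> nat -> R.
Hypothesis FE : forall j n, F j n = b n j + F j n.+1.
Hypothesis F0 : forall j n, 0 <= F j n.
Hypothesis Fdel : forall j, F j 0%N <= del / 2.
Hypothesis Flim : forall j e, 0 < e -> exists n0, forall n, (n0 <= n)%N -> F j n <= e.

Let grow1 : 1 <= growth. Proof. exact: growth_ge1. Qed.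
Let grow0 : 0 <= growth. Proof. by rewrite (le_trans ler01). Qed.
Let cA0 : 0 <= cA. Proof. by rewrite /cA mulr_ge0// mulr_ge0. Qed.
Let Q01 : 3 <= Q0. Proof. by rewrite /Q0; have := grow1; lra. Qed.

Lemma tail_mono j m n : (m <= n)%N -> F j n <= F j m.
Proof.
move=> /subnKC <-; elim: (n - m)%N => [|d]; first by rewrite addn0.
by apply: le_trans; rewrite addnS (FE j (m + d)) lerDr.
Qed.

Lemma tail_sum j M n :
  \sum_(l < n) (if (M <= l)%N then b l j else 0) + F j (maxn M n) = F j M.
Proof.
elim: n => [|n IH]; first by rewrite big_ord0 add0r maxn0.
rewrite big_ord_recr /= -[RHS]IH; case: (leqP M n) => Mn.
  by rewrite (maxn_idPr (leqW Mn)) (FE j n); ring.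
by rewrite addr0 (maxn_idPl Mn).
Qed.

Lemma tail_sum_le j M n :
  \sum_(l < n) (if (M <= l)%N then b l j else 0) <= F j M.
Proof. by rewrite -(tail_sum j M n) lerDl. Qed.

Lemma row_sum_le n N : \sum_(j < N) b n j <= del / 2.
Proof.
apply: le_trans (Fdel n); apply: le_trans (tail_sum_le n 0 N).
by apply: ler_sum => j _; rewrite bC.
Qed.

Definition stage Q n u D G W : Prop :=
  [/\ invariant n u D G,
      forall j, 0 < W j <= 1,
      forall j, (n <= j)%N -> W j = 1,
      forall l, (l < n)%N -> pot cA W (F^~ n) G n l <= Q &
      (forall j, F j n <= del * W j) /\
      forall n', (n <= n')%N -> \sum_(j < n') b n' j / W j <= del].

Lemma stage_entry Q n u D G W l m : stage Q n u D G W ->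
  (l < n)%N -> (m < n)%N -> 0 <= G l m.
Proof.
move=> [[_ _ _ DG _] _ _ _ _] ln mn; apply: le_trans (DG l m None None None ln mn).
exact: normc_ge0.
Qed.

Lemma stage_row Q n u D G W l : stage Q n u D G W -> (l < n)%N ->
  W l * \sum_(m < n) G l m * W m <= Q.
Proof.
move=> st ln; have [_ W01 _ P _] := st; apply: le_trans (P l ln).
have /andP[/ltW Wl _] := W01 l; rewrite ler_wpM2l//; apply: ler_sum => m _.
by rewrite ler_wpM2l ?(stage_entry st)// lerDl mulr_ge0.
Qed.

Lemma stage_norm Q n u D G W l r : stage Q n u D G W -> (l < n)%N ->
  nm (D l r) ^+ 2 <= Q / W l ^+ 2.
Proof.
move=> st ln; have [[_ _ _ DG _] W01 _ _ _] := st.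
have /andP[Wl _] := W01 l; rewrite ler_pdivlMr ?exprn_gt0//.
apply: le_trans (stage_row st ln); rewrite (bigD1 (Ordinal ln))//=.
have := DG l l None r r ln ln; rewrite /= -hnorm_sqr normc_real ger0_norm ?sqr_ge0// => h.
apply: (@le_trans _ _ (W l * (G l l * W l))).
  by rewrite mulrC expr2 -mulrA [G l l * _]mulrC ler_wpM2l ?(ltW Wl)// ler_wpM2l ?(ltW Wl).
rewrite ler_wpM2l ?(ltW Wl)// lerDl; apply: sumr_ge0 => m _.
by rewrite mulr_ge0 ?(stage_entry st)//; have /andP[/ltW] := W01 m.
Qed.

(** For the norm, write [b n l * b n m * G l m] as [b n l / W l] times [b n m / W m] times
    [W l * G l m * W m]: the first factors sum to at most [del], the second are at most [del], the
    rows of the third at most [2 * Q0]. For the potential, the increase [3 * growth * W l * x l]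
    equals what the passage from [F m n] to [F m n.+1] releases. *)
Lemma stage_regular Q n u D G W (V : seq H) : stage Q n u D G W ->
  Q0 <= Q -> Q <= 2 * Q0 ->
  exists u' D' G', [/\ stage Q n.+1 u' D' G' W,
    forall i, (i < n)%N -> u' i = u i &
    forall y, y \in V -> [/\ forall r, decoupled (D' n r) y,
      forall l r, (l < n)%N -> decoupled (D l r) y -> decoupled (D' l r) y &
      normc (ip (u' n) y) <= \sum_(l < n) \sum_(r : idx) b n l * normc (ip (D l r) y)]].
Proof.
move=> st Q0Q Q2; have [inv W01 W1 P [FW bW]] := st.
have W0 j : 0 < W j by have /andP[] := W01 j.
have Wge j : 0 <= W j by apply: ltW.
have G0 (l m : 'I_n) : 0 <= G l m by apply: (stage_entry st).
have [_ _ _ _ Gs] := inv.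
have row (l : 'I_n) : W l * \sum_(m < n) G l m * W m <= 2 * Q0.
  by apply: le_trans Q2; apply: (stage_row st).
have bd j N : (n <= N)%N -> (j < N)%N -> b N j / W j <= del.
  move=> nN jN; apply: le_trans (bW N nN); rewrite (bigD1 (Ordinal jN))//= lerDl.
  by apply: sumr_ge0 => i _; rewrite divr_ge0.
have bW0 j : 0 <= b n j / W j by rewrite divr_ge0.
have quad : mm ^+ 2 * (\sum_(l < n) \sum_(m < n) b n l * b n m * G l m) <= s.
  apply: le_trans delS; rewrite ler_wpM2l ?exprn_ge0//.
  apply: (@le_trans _ _ (\sum_(l < n) b n l / W l * (del * (2 * Q0)))).
    apply: ler_sum => l _.
    apply: (@le_trans _ _ (b n l / W l * (del * (W l * \sum_(m < n) G l m * W m)))).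
      rewrite !mulr_sumr; apply: ler_sum => m _.
      rewrite [leLHS](_ : _ = b n l / W l * (b n m / W m * (W l * (G l m * W m)))); last first.
        by field; rewrite !gt_eqF.
      rewrite ler_wpM2l// ler_wpM2r ?bd//.
      by rewrite !mulr_ge0.
    by rewrite ler_wpM2l// ler_wpM2l ?(ltW del0).
  rewrite -mulr_suml ler_wpM2r ?bW//.
  by rewrite mulr_ge0 ?(ltW del0)// mulr_ge0//; have := Q01; lra.
have [u' [D' [inv' uu VV]]] :=
  regular_step V inv quad.
pose x l := mm * \sum_(j < n) b n j * G l j.
have x0 j : (j < n)%N -> 0 <= x j.
  move=> jn; rewrite mulr_ge0// sumr_ge0// => i _; rewrite mulr_ge0//.
  exact: (G0 (Ordinal jn)).
have Ag j : 0 <= cA * F j n.+1 <= W j.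
  rewrite mulr_ge0//=; apply: (@le_trans _ _ (cA * (del * W j))).
    by rewrite ler_wpM2l// (le_trans _ (FW j))// (FE j n) lerDr.
  by rewrite mulrA ler_piMl.
have xW : \sum_(j < n) x j * W j <= 4^-1.
  apply: le_trans delQ; rewrite /x; under eq_bigr do rewrite -mulrA mulr_suml.
  rewrite -mulr_sumr ler_wpM2l// exchange_big /=.
  apply: (@le_trans _ _ (\sum_(j < n) b n j / W j * (2 * Q0))).
    apply: ler_sum => j _.
    apply: (@le_trans _ _ (b n j / W j * (W j * \sum_(m < n) G j m * W m))).
      rewrite !mulr_sumr; apply: ler_sum => m _; rewrite (Gs m j)//.
      by rewrite le_eqVlt; apply/orP; left; apply/eqP; field; rewrite gt_eqF.
    by rewrite ler_wpM2l.
  by rewrite -mulr_suml ler_wpM2r ?bW// mulr_ge0//; have := Q01; lra.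
have [pl pn] := @pot_upd _ cA growth W (F^~ n.+1) x G n cA0 grow0 x0 W01
  (fun j _ => Ag j) (W1 n (leqnn n)) xW.
exists u', D', (upd n growth x G); split=> //; split=> //.
- by move=> j nj; apply: W1; apply: ltnW.
- move=> l; rewrite ltnS leq_eqVlt => /orP[/eqP ->|ln]; first exact: le_trans Q0Q.
  apply: le_trans (pl l ln) _; apply: le_trans (P l ln).
  rewrite /pot -/x [3 * growth * _]mulrCA -mulrDr ler_wpM2l//.
  rewrite le_eqVlt; apply/orP; left; apply/eqP.
  rewrite /x mulrA mulr_sumr -big_split /=; apply: eq_bigr => m _.
  by rewrite (FE m n) /cA; ring.
- split=> [j|n' nn']; last by apply: bW; apply: ltnW.
  by rewrite (le_trans _ (FW j))// (FE j n) lerDr.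
Qed.

(** Duals created from [n] on are kept decoupled from [g], so a new vector can correlate with [g]
    only through the first [n] duals, that is, through its entries linked to the first [n]
    indices. *)
Lemma stage_run Q n u D G W g N c : stage Q n u D G W -> Q0 <= Q -> Q <= 2 * Q0 ->
  nm g <= 1 -> (forall j, (j < n)%N -> Q / W j ^+ 2 <= c ^+ 2) -> 0 <= c -> (n <= N)%N ->
  exists u' D' G', [/\ stage Q N u' D' G' W,
    forall i, (i < n)%N -> u' i = u i,
    forall l r, (n <= l)%N -> (l < N)%N -> decoupled (D' l r) g &
    forall l, (n <= l)%N -> (l < N)%N ->
      normc (ip (u' l) g) <= mm * c * \sum_(j < n) b l j].
Proof.
move=> st Q0Q Q2 g1 Wc c0 /subnKC <-; elim: (N - n)%N => [|d [u1 [D1 [G1 [st1 uu dg ug]]]]].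
  exists u, D, G; rewrite addn0; split=> // [l r|l] nl ln;
    by move: (leq_ltn_trans nl ln); rewrite ltnn.
have [u2 [D2 [G2 [st2 uu2 /(_ g (mem_head _ _)) [dN dl uN]]]]] :=
  stage_regular [:: g] st1 Q0Q Q2.
exists u2, D2, G2; rewrite addnS; split=> //.
- by move=> i lt; rewrite uu2 ?uu// ltn_addr.
- move=> l r nl; rewrite ltnS leq_eqVlt => /orP[/eqP -> //|lt].
  by apply: dl => //; apply: dg.
- move=> l nl; rewrite ltnS leq_eqVlt => /orP[/eqP ->|lt]; last first.
    by rewrite uu2// ug.
  apply: le_trans uN _.
  rewrite big_split_ord /= [X in _ + X]big1 ?addr0; last first.
    move=> j _; rewrite big1// => r _.
    have := dg (n + j)%N r (leq_addr _ _); rewrite ltn_add2l => /(_ (ltn_ord j) None).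
    by rewrite /= => ->; rewrite normc0 mulr0.
  rewrite mulr_sumr; apply: ler_sum => j _.
  have -> : mm * c * b (n + d)%N j = \sum_(r : idx) b (n + d)%N j * c.
    by rewrite sumr_const -mulr_natl -/mm; ring.
  apply: ler_sum => r _; rewrite ler_wpM2l// (le_trans (ip_le _ _ _))//.
  have jn : (j < n + d)%N by rewrite ltn_addr.
  have h : nm (D1 j r) <= c.
    rewrite -(ler_pXn2r (n:=2)) ?nnegrE ?hnorm_ge0//.
    by apply: le_trans (stage_norm r st1 jn) (Wc j (ltn_ord j)).
  by rewrite -[leRHS]mulr1 ler_pM ?hnorm_ge0.
Qed.

Lemma sum_initial (x : R) M p : (M <= p)%N ->
  \sum_(l < p) (if (l < M)%N then x else 0) = M%:R * x.
Proof.
move=> Mp; rewrite -big_mkcond /= -(big_ord_widen p (fun=> x) Mp).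
by rewrite sumr_const card_ord mulr_natl.
Qed.

(* The rows before [M] get a tiny weight [theta]: the new vector may be badly
   correlated with them, but the entries still to be prescribed there sum to
   less than [theta * del]. The rows after [M] are almost decoupled from [g]. *)
Lemma stage_step i n u D G W g :
  stage (Q0 * (2 - 2^-1 ^+ i)) n u D G W -> nm g <= 1 ->
  exists n' u' D' G' W', [/\ stage (Q0 * (2 - 2^-1 ^+ i.+1)) n' u' D' G' W',
    (n < n')%N, forall j, (j < n)%N -> u' j = u j &
    exists p, [/\ (n <= p)%N, (p < n')%N &
      ip g (u' p) = (Num.sqrt s * nm (residual ip p u' g) ^+ 2)%:C]].
Proof.
move=> st g1; set q : R := 2^-1 ^+ i; set Q := Q0 * (2 - q) in st *.
have q0 : 0 < q by rewrite exprn_gt0// invr_gt0.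
have q1 : q <= 1 by rewrite exprn_ile1// ?invr_ge0// invf_le1//; lra.
have Q3 := Q01; have Q0Q : Q0 <= Q by rewrite /Q; nra.
have Q2 : Q <= 2 * Q0 by rewrite /Q; nra.
have [_ W01 W1 _ _] := st.
have W0 j : 0 < W j by have /andP[] := W01 j.
(* One constant for two purposes: dual norms are at most [c] by [stage_norm], and weights are at
   least [1 / c]. *)
pose c := 1 + \sum_(j < n) Q / W j ^+ 2 + Q.
have QW0 j : 0 <= Q / W j ^+ 2 by rewrite divr_ge0 ?exprn_ge0 ?(ltW (W0 j))//; lra.
have S0 : 0 <= \sum_(j < n) Q / W j ^+ 2 by apply: sumr_ge0.
have c1 : 1 <= c by rewrite /c; lra.
have Qc j : Q / W j ^+ 2 <= c.
  have [jn|nj] := ltnP j n; last by rewrite W1// expr1n divr1 /c; lra.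
  have : Q / W j ^+ 2 <= \sum_(j < n) Q / W j ^+ 2.
    by rewrite (bigD1 (Ordinal jn))//= lerDl sumr_ge0.
  by rewrite /c; lra.
have c2 : c <= c ^+ 2 by rewrite expr2 ler_peMl//; lra.
have Wc j : c^-1 <= W j.
  have W2 : W j ^+ 2 <= W j.
    by rewrite expr2 ger_pMr//; have /andP[] := W01 j.
  apply: le_trans W2; rewrite -[c^-1]mul1r ler_pdivrMr; last by lra.
  have := Qc j; rewrite ler_pdivrMr ?exprn_gt0// mulrC; lra.
have mc0 : 0 < mm * c by rewrite mulr_gt0 ?(lt_le_trans _ nforms_ge1)//; lra.
(* Beyond [M] the entries linked to the first [n] indices are so small that the correlations with
   [g] found in [stage_run] total at most [q / 8]. *)
have e0 : 0 < q / 4 / (2 * (mm * c) * n.+1%:R).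
  by rewrite divr_gt0 ?divr_gt0// mulr_gt0 ?ltr0n// mulr_gt0.
have [M0 hM0] := eventually_all (fun j : 'I_n => Flim j e0).
pose M := maxn n M0; have nM : (n <= M)%N by apply: leq_maxl.
have FM : mm * c * \sum_(j < n) F j M <= q / 8.
  apply: (@le_trans _ _ (mm * c * \sum_(j < n) q / 4 / (2 * (mm * c) * n.+1%:R))).
    by rewrite ler_wpM2l ?(ltW mc0)//; apply: ler_sum => j _; apply: hM0; apply: leq_maxr.
  rewrite sumr_const card_ord -mulr_natl.
  have n1 : n%:R <= n.+1%:R :> R by rewrite ler_nat.
  have n10 : 0 < n.+1%:R :> R by rewrite ltr0n.
  rewrite (_ : _ * _ = q / 8 * (n%:R / n.+1%:R)); last first.
    by field; rewrite !gt_eqF// ?(lt_le_trans _ nforms_ge1)//; lra.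
  by rewrite ler_piMr ?divr_ge0 ?(ltW q0)// ler_pdivrMr// mul1r.
have M10 : 0 < M.+1%:R :> R by rewrite ltr0n.
have M11 : 1 <= M.+1%:R :> R by rewrite ler1n.
have Mle : M%:R <= M.+1%:R :> R by rewrite ler_nat.
have Kc0 : 0 < K * c by rewrite mulr_gt0//; have := K1; lra.
(* The [M] early rows, where only the crude bound [K * c] is known, then weigh at most [q / 8]
   together. [M.+1] avoids dividing by zero. *)
pose th := q / (8 * M.+1%:R * (K * c)).
have den0 : 0 < 8 * M.+1%:R * (K * c) by rewrite mulr_gt0// mulr_gt0.
have th0 : 0 < th by rewrite divr_gt0.
have thKc : M%:R * (K * c * th) <= q / 8.
  rewrite (_ : _ * _ = q / 8 * (M%:R / M.+1%:R)); last first.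
    by rewrite /th; field; rewrite !gt_eqF//; have := K1; lra.
  by rewrite ler_piMr ?divr_ge0 ?(ltW q0)// ler_pdivrMr// mul1r.
have thc : th <= c^-1.
  rewrite /th ler_pdivrMr//.
  have -> : c^-1 * (8 * M.+1%:R * (K * c)) = 8 * M.+1%:R * K.
    by field; rewrite gt_eqF//; lra.
  by have := K1; nra.
have thW j : th <= W j by apply: le_trans (Wc j).
have th1 : th <= 1 by apply: le_trans (thW n) _; have /andP[] := W01 n.
(* Divided by the weight [th], the entries left in the [M] early columns use at most half of [del];
   the other half is for the indices of weight 1. *)
have f0 : 0 < th * (del / 2) / M.+1%:R by rewrite divr_gt0// mulr_gt0// divr_gt0.
have [N0 hN0] := eventually_all (fun j : 'I_M => Flim j f0).
have [p Np frp] := free (maxn M N0).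
have Mp : (M <= p)%N by apply: leq_trans Np; apply: leq_maxl.
have Fp j : (j < M)%N -> F j p <= th * (del / 2) / M.+1%:R.
  by move=> jM; apply: (hN0 p _ (Ordinal jM)); apply: leq_trans Np; apply: leq_maxr.
have np : (n <= p)%N by apply: leq_trans Mp.
have [||u1 [D1 [G1 [st1 uu dg ug]]]] := stage_run (c := c) st Q0Q Q2 g1 _ _ np.
- by move=> j _; apply: le_trans (Qc j) c2.
- by lra.
have [inv1 _ _ P1 _] := st1.
have [uo1 _ Du1 _ _] := inv1.
pose W' l : R := if (l < M)%N then th else 1.
pose x l : R := if (l < M)%N then K * c else mm * c * \sum_(j < n) b l j.
have sb0 l : 0 <= \sum_(j < n) b l j by apply: sumr_ge0.
have x0 l : 0 <= x l.
  by rewrite /x; case: ifP => _; [apply: ltW|apply: mulr_ge0 => //; apply: ltW].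
have W'01 j : 0 < W' j <= 1 by rewrite /W'; case: ifP => _; rewrite ?th0 ?th1 ?ltr01 /=.
have W'0 j : 0 <= W' j by have /andP[/ltW] := W'01 j.
have W'W j : W' j <= W j.
  by rewrite /W'; case: (ltnP j M) => // /(leq_trans nM) /W1 ->.
have D1c l r : (l < p)%N -> nm (D1 l r) <= c.
  move=> lp; rewrite -(ler_pXn2r (n:=2)) ?nnegrE ?hnorm_ge0//; last by rewrite (le_trans ler01).
  apply: le_trans (stage_norm r st1 lp) _; exact: le_trans (Qc l) c2.
have sq1 : Num.sqrt s <= 1 by rewrite -[leRHS]sqrtr1 ler_wsqrtr.
have r1 : nm (residual ip p u1 g) <= 1 by apply: le_trans (residual_norm g uo1) g1.
have xD l p' r : (l < p)%N ->
    normc (form p' (D1 l r) ((Num.sqrt s)%:C *: residual ip p u1 g)) <= x l.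
  move=> lp; rewrite formZr conjc_real normcM normc_real ger0_norm ?sqrtr_ge0//.
  apply: (@le_trans _ _ (normc (form p' (D1 l r) (residual ip p u1 g)))).
    by rewrite ler_piMl ?normc_ge0.
  rewrite /x; case: ltnP => lM.
    rewrite (le_trans (form_le _ _ _))// ler_wpM2l//.
    by rewrite -[leRHS]mulr1 ler_pM ?hnorm_ge0// D1c.
  have nl := leq_trans nM lM.
  (* [D1 l r] does not see [g], and of the projection of [g] only the component along [u1 l]
     survives. *)
  rewrite formBr (dg l r nl lp) sub0r normcN form_sumr (bigD1 (Ordinal lp))//=.
  rewrite big1 ?addr0; last first.
    move=> j jl; rewrite formZr Du1// eq_sym (negPf (jl : (j : nat) != l)) mulr0//.
  rewrite formZr Du1// eqxx /= normcM -ipC.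
  apply: le_trans (ug l nl lp); rewrite ler_piMr ?normc_ge0//.
  by case: (p' == r); rewrite ?normc0 ?normc1.
have xW : \sum_(l < p) x l * W' l <= q / 4.
  have -> : \sum_(l < p) x l * W' l =
      \sum_(l < p) (if (l < M)%N then K * c * th else 0) +
      mm * c * \sum_(j < n) \sum_(l < p) (if (M <= l)%N then b l j else 0).
    rewrite exchange_big /= mulr_sumr -big_split /=; apply: eq_bigr => l _.
    rewrite /x /W'; case: ltnP => lM; first by rewrite big1 ?mulr0 ?addr0.
    by rewrite mulr1 add0r.
  rewrite sum_initial//.
  apply: (@le_trans _ _ (q / 8 + mm * c * \sum_(j < n) F j M)).
    rewrite lerD// ler_wpM2l ?(ltW mc0)//; apply: ler_sum => j _.
    exact: tail_sum_le.
  by lra.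
have FW' j : F j p <= del * W' j.
  rewrite /W'; case: ltnP => jM.
    apply: le_trans (Fp j jM) _; rewrite ler_pdivrMr//.
    have : 0 < th * del by rewrite mulr_gt0.
    by nra.
  by rewrite mulr1 (le_trans (tail_mono j (leq0n p)))// (le_trans (Fdel j))// ler_pdivrMr// ler_peMr ?(ltW del0)// ler1n.
have Ag j : (j <= p)%N -> 0 <= cA * F j p.+1 <= W' j.
  move=> _; rewrite mulr_ge0//=; apply: (@le_trans _ _ (cA * (del * W' j))).
    by rewrite ler_wpM2l// (le_trans _ (FW' j))// tail_mono.
  by rewrite mulrA ler_piMl.
have W'p : W' p = 1 by rewrite /W' ltnNge Mp.
have xW4 : \sum_(l < p) x l * W' l <= 4^-1 by lra.
have [u2 [D2 [inv2 uu2 gu]]] := absorb_step inv1 g1 frp xD.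
have [pl pn] := pot_upd G1 cA0 grow0 (fun j _ => x0 j) W'01 Ag W'p xW4.
(* The increments allowed to the absorbing steps form a geometric series, which keeps every bound
   below [2 * Q0]. *)
have Q'E : Q0 * (2 - 2^-1 ^+ i.+1) = Q + Q0 * (q / 2).
  by rewrite exprSr -/q /Q; field.
have res : residual ip p u2 g = residual ip p u1 g.
  by rewrite /residual; congr (_ - _); apply: eq_bigr => j _; rewrite uu2.
exists p.+1, u2, D2, (upd p growth x G1), W'; split.
- split=> //.
  + by move=> j pj; rewrite /W' ltnNge (leq_trans Mp)// ltnW.
  + move=> l; rewrite Q'E ltnS leq_eqVlt => /orP[/eqP ->|lp].
      by apply: le_trans pn _; rewrite -/Q0; nra.
    apply: le_trans (pl l lp) _; apply: lerD.
      apply: le_trans (P1 l lp); rewrite /pot ler_pM//.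
        apply: sumr_ge0 => m _; rewrite mulr_ge0 ?(stage_entry st1)// addr_ge0//.
        by rewrite mulr_ge0.
      apply: ler_sum => m _; rewrite ler_wpM2l ?(stage_entry st1)// lerD//.
      by rewrite ler_wpM2l// tail_mono.
    have : W' l * x l <= q / 4.
      apply: le_trans xW; rewrite (bigD1 (Ordinal lp))//= mulrC lerDl.
      by apply: sumr_ge0 => m _; rewrite mulr_ge0.
    by move=> h; rewrite -/Q0; apply: ler_wpM2l; lra.
  + split=> [j|n' pn'].
      by apply: le_trans (FW' j); apply: tail_mono.
    have Mn' : (M <= n')%N by apply: leq_trans Mp _; apply: ltnW.
    apply: (@le_trans _ _ (\sum_(j < n') (if (j < M)%N then del / 2 / M.+1%:R else 0) +
        \sum_(j < n') b n' j)).
      rewrite -big_split /=; apply: ler_sum => j _; rewrite /W'; case: ltnP => jM.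
        apply: (@le_trans _ _ (del / 2 / M.+1%:R)); last by rewrite lerDl.
        rewrite ler_pdivrMr// [leRHS](_ : _ = th * (del / 2) / M.+1%:R); last by ring.
        apply: le_trans (Fp j jM); apply: le_trans (tail_mono j (ltnW pn')).
        by rewrite FE bC lerDl.
      by rewrite divr1 add0r.
    rewrite sum_initial// [leRHS]splitr lerD ?row_sum_le//.
    by rewrite mulrA ler_pdivrMr// mulrC ler_wpM2l// divr_ge0 ?(ltW del0).
- by rewrite ltnS.
- by move=> j jn; rewrite uu2 ?uu// (leq_trans jn).
- by exists p; split=> //; rewrite gu res.
Qed.

(** Later stages never change earlier vectors, so [u j] can be read off stage [j.+1], the first one
    sure to contain index [j]. *)
Lemma prescribed_system (g : nat -> H) : (forall i, nm (g i) <= 1) ->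
  exists u : nat -> H, [/\ forall i j, ip (u i) (u j) = (i == j)%:R,
    forall i j t, B i j \/ i = j -> ip (T t (u j)) (u i) = a i j t &
    forall i, exists2 p, (i <= p)%N &
      ip (g i) (u p) = (Num.sqrt s * nm (residual ip p u (g i)) ^+ 2)%:C].
Proof.
move=> g1; pose S := (nat * (nat -> H) * (nat -> idx -> H) * (nat -> nat -> R) * (nat -> R))%type.
pose sn (x : S) := x.1.1.1.1; pose su (x : S) := x.1.1.1.2.
pose P i (x : S) := stage (Q0 * (2 - 2^-1 ^+ i)) (sn x) (su x) x.1.1.2 x.1.2 x.2.
pose Q i (x y : S) := [/\ (sn x < sn y)%N, forall j, (j < sn x)%N -> su y j = su x j &
  exists p, [/\ (sn x <= p)%N, (p < sn y)%N &
    ip (g i) (su y p) = (Num.sqrt s * nm (residual ip p (su y) (g i)) ^+ 2)%:C]].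
have [|i x Px|f fP] := @dependent_choice_seq _ P Q.
- exists (0%N, fun=> 0, fun _ _ => 0, fun _ _ => 0, fun=> 1); split=> //=.
  + by move=> j; rewrite ltr01 lexx.
  + split=> [j|n' _].
      rewrite mulr1 (le_trans (Fdel j))// ler_pdivrMr// ler_peMr ?(ltW del0)//.
      by rewrite ler1n.
    under eq_bigr do rewrite divr1; apply: le_trans (row_sum_le n' n') _.
    by rewrite ler_pdivrMr// ler_peMr ?(ltW del0)// ler1n.
- have [n' [u' [D' [G' [W' [st' nn' uu' ex]]]]]] := stage_step Px (g1 i).
  by exists (n', u', D', G', W').
have sni i : (i <= sn (f i))%N.
  elim: i => // i IH; apply: leq_ltn_trans IH _.
  by have [_ [h _ _]] := fP i.
have agree i d j : (j < sn (f i))%N -> su (f (i + d)%N) j = su (f i) j.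
  move=> ji; have : (j < sn (f (i + d)%N))%N /\ su (f (i + d)%N) j = su (f i) j.
    elim: d => [|d [jd e]]; first by rewrite addn0.
    have [_ [h ag _]] := fP (i + d)%N; rewrite addnS; split; last by rewrite ag.
    exact: ltn_trans h.
  by case.
pose u j := su (f j.+1) j.
have uE i j : (j < sn (f i))%N -> u j = su (f i) j.
  move=> ji; have [le|le] := leqP j.+1 i.
    by rewrite -(subnKC le) agree.
  by rewrite /u -(subnKC (ltnW le)) agree.
have uS i j : u i = su (f (maxn i j).+1) i /\ u j = su (f (maxn i j).+1) j.
  have h := sni (maxn i j).+1.
  by split; apply: uE; apply: leq_trans h; rewrite ltnS ?leq_maxl ?leq_maxr.
have ltS i j : (i < sn (f (maxn i j).+1))%N /\ (j < sn (f (maxn i j).+1))%N.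
  have h := sni (maxn i j).+1.
  by split; apply: leq_trans h; rewrite ltnS ?leq_maxl ?leq_maxr.
exists u; split.
- move=> i j; have [-> ->] := uS i j; have [li lj] := ltS i j.
  by have [[[uo _ _ _ _] _ _ _ _] _] := fP (maxn i j).+1; apply: uo.
- move=> i j t Bij; have [-> ->] := uS i j; have [li lj] := ltS i j.
  by have [[[_ uB _ _ _] _ _ _ _] _] := fP (maxn i j).+1; apply: uB.
- move=> i; have [_ [_ _ [p [np pn gp]]]] := fP i.
  exists p; first exact: leq_trans np.
  rewrite (uE i.+1)// gp; congr ((_ * nm (_ - _) ^+ 2)%:C).
  by apply: eq_bigr => j _; rewrite (uE i.+1)// (ltn_trans _ pn).
Qed.

End Recursion.

(** * Vanishing of the residuals *)

Section Density.
Variables (R : realType) (H : lmodType R[i]) (ip : {dot H for Num.conj}).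
Local Notation nm := (hnorm ip).

(** By Bessel the inner products of [g] with [u p] tend to 0, and infinitely often they are a fixed
    multiple of the squared residual. *)
Lemma residual_lim0 (u : nat -> H) g s : 0 < s ->
  (forall i j, ip (u i) (u j) = (i == j)%:R) ->
  (forall N, exists2 p, (N <= p)%N &
    ip g (u p) = (Num.sqrt s * nm (residual ip p u g) ^+ 2)%:C) ->
  forall e, 0 < e -> exists p, nm (residual ip p u g) <= e.
Proof.
move=> s0 uo ex e e0; have ss : 0 < Num.sqrt s by rewrite sqrtr_gt0.
have sum n : \sum_(i < n) normc (ip g (u i)) ^+ 2 <= nm g ^+ 2.
  by rewrite (residual_pyth (n := n) g (fun i j _ _ => uo i j)) lerDr sqr_ge0.
have d0 : 0 < (Num.sqrt s * e ^+ 2) ^+ 2 by rewrite exprn_gt0// mulr_gt0// exprn_gt0.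
have [n0 h0] := summable_terms (fun i => sqr_ge0 (normc (ip g (u i)))) sum d0.
have [p np gp] := ex n0; exists p; have := h0 p np.
have r0 : 0 <= nm (residual ip p u g) ^+ 2 by apply: sqr_ge0.
rewrite gp normc_real ger0_norm; last by rewrite mulr_ge0// ltW.
rewrite ler_pXn2r ?nnegrE ?mulr_ge0 ?exprn_ge0 ?hnorm_ge0 ?(ltW ss) ?(ltW e0)// ler_pM2l//.
by rewrite ler_pXn2r ?nnegrE ?hnorm_ge0 ?(ltW e0).
Qed.

End Density.

(** * Reordering the indices by admissibility *)

Section Reordering.
Variable B : nat -> nat -> Prop.
Hypothesis adm : forall m, exists n, (m < n)%N /\
  forall j, (j <= m)%N -> ~ B j n /\ ~ B n j.

(* Alternate between the least unused index and an index unrelated to all the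
   used ones. *)
Lemma free_reordering : exists f f' : nat -> nat, [/\ cancel f f', cancel f' f &
  forall N, exists2 n, (N <= n)%N &
    forall i, (i < n)%N -> ~ B (f n) (f i) /\ ~ B (f i) (f n)].
Proof.
have bound (s : seq nat) x : x \in s -> (x <= \max_(y <- s) y)%N.
  by move=> xs; apply: leq_bigmax_seq.
have /choice[g gP] (s : seq nat) : exists x, x \notin s /\
    if odd (size s) then forall j, j \in s -> ~ B x j /\ ~ B j x
    else forall y, (y < x)%N -> y \in s.
  case: (odd (size s)).
    have [n [mn nB]] := adm (\max_(y <- s) y)%N; exists n; split.
      by apply/negP => /bound; rewrite leqNgt mn.
    by move=> j /bound /nB [].
  have ex : exists x, x \notin s.
    exists (\max_(y <- s) y).+1; apply/negP => /bound.
    by rewrite ltnn.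
  exists (ex_minn ex); case: ex_minnP => x xs le; split=> // y yx.
  by apply: contraTT yx => /le; rewrite -leqNgt.
pose S n := iter n (fun s => rcons s (g s)) [::].
pose f n := g (S n).
have sizeS n : size (S n) = n by elim: n => //= n IH; rewrite size_rcons IH.
have fS i n : (i < n)%N -> f i \in S n.
  elim: n => // n IH; rewrite ltnS leq_eqVlt /= mem_rcons inE => /orP[/eqP ->|/IH ->].
    by rewrite eqxx.
  by rewrite orbT.
have Smono m n x : (m <= n)%N -> x \in S m -> x \in S n.
  move=> /subnKC <- xm; elim: (n - m)%N => [|d IH]; first by rewrite addn0.
  by rewrite addnS /= mem_rcons inE IH orbT.
have Sf x n : x \in S n -> exists i, f i = x.
  elim: n => //= n IH; rewrite mem_rcons inE => /orP[/eqP ->|/IH //].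
  by exists n.
have finj : injective f.
  have lt i j : (i < j)%N -> f i <> f j.
    move=> /fS ij e; have [] := gP (S j); rewrite -/(f j) -e.
    by rewrite ij.
  by move=> i j e; case: (ltngtP i j) => // /lt; rewrite e.
(* By step [2 * y] all smaller numbers have been used, so the even step taken there picks [y] if it
   is still missing. *)
have fsurj y : y \in S (y.*2.+1).
  elim/ltn_ind: y => y IH; rewrite /= mem_rcons inE.
  have [//|ny] := boolP (y \in S y.*2); first by rewrite orbT.
  have [nS] := gP (S y.*2); rewrite sizeS odd_double => least.
  case: (ltnP y (g (S y.*2))) => [lt|ge]; first by move: ny; rewrite least.
  case: (ltnP (g (S y.*2)) y) => [gt|le]; last by rewrite eqn_leq le ge.
  have /negP[] := nS; apply: Smono (IH _ gt).
  by rewrite ltn_double.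
have /choice[f' f'P] y : exists n, f n = y by apply: Sf (fsurj y).
exists f, f'; split=> [n|//|N]; first by apply: finj; apply: f'P.
exists N.*2.+1; first by rewrite -addnn -addSn leq_addl.
move=> i /fS iS; have [_] := gP (S N.*2.+1).
by rewrite sizeS /= odd_double => /(_ _ iS).
Qed.

End Reordering.

(** * Complex tuples: neighbourhoods, distances and sums of entries *)

Section ComplexSpaces.
Variable R : realType.

Lemma gt0_complexE (e : R[i]) : 0 < e -> e = (complex.Re e)%:C /\ 0 < complex.Re e.
Proof. by case: e => a b; rewrite ltcE /= => /andP[/eqP -> ?]. Qed.

Lemma realC_gt0 (e : R) : 0 < e -> 0 < e%:C :> R[i].
Proof. by rewrite ltcE /= eqxx. Qed.

Lemma normc_lt (z : R[i]) (e : R) : (`|z| < e%:C) = (normc z < e).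
Proof. by rewrite cnormE ltcR. Qed.

Lemma normc_le (z : R[i]) (e : R) : (`|z| <= e%:C) = (normc z <= e).
Proof. by rewrite cnormE lecR. Qed.

Lemma nbhs_rV k (x : 'rV[R[i]]_k) (U : set 'rV[R[i]]_k) : nbhs x U ->
  exists2 e : R, 0 < e & forall y : 'rV[R[i]]_k,
    (forall t, normc (y 0 t - x 0 t) < e) -> U y.
Proof.
move=> /nbhs_ballP[e /= ep eU]; have [eE e0] := gt0_complexE ep.
exists (complex.Re e) => // y xy; apply: eU; split=> // i t.
by rewrite ord1 /ball /= eE normc_lt normcB.
Qed.

Lemma cvg_rV_normc (s : nat -> R[i]) (l : R[i]) : s n @[n --> \oo] --> l ->
  forall e : R, 0 < e -> exists n0, forall n, (n0 <= n)%N -> normc (s n - l) <= e.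
Proof.
move=> /cvgrPdist_le sl e /realC_gt0 /sl [n0 _ h]; exists n0 => n /h /=.
by rewrite normc_le normcB.
Qed.

(** Passes from the extended sums of the theorem to finite real sums over reordered indices. *)
Lemma esum_injective_le (A : set nat) (h : nat -> R) (f : nat -> nat) (d : R) N :
  (forall i, 0 <= h i) -> injective f ->
  (\esum_(j in A) (h j)%:E <= d%:E)%E ->
  \sum_(i < N) (if f i \in A then h (f i) else 0) <= d.
Proof.
move=> h0 finj le; rewrite -lee_fin; apply: le_trans le; apply: esum_ge.
pose r := [seq j <- [seq f i | i <- iota 0 N] | j \in A].
have ur : uniq r by rewrite filter_uniq// map_inj_uniq// iota_uniq.
exists [set` r].
  split; first exact: finite_seq.
  by move=> j /=; rewrite mem_filter => /andP[/set_mem].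
rewrite -fsbig_seq// sumEFin big_filter big_map lee_fin.
rewrite -(big_mkord xpredT (fun i => if f i \in A then h (f i) else 0)).
by rewrite /index_iota subn0 -big_mkcond.
Qed.

Variable k : nat.
Implicit Types a p : 'rV[R[i]]_k.

Lemma euclid_distZ a p (c : R) : 0 <= c ->
  euclid_dist a (a + c%:C *: (p - a)) = c * euclid_dist a p.
Proof.
move=> c0; rewrite /euclid_dist -[c in RHS]ger0_norm// -sqrtr_sqr -sqrtrM ?sqr_ge0//.
congr (Num.sqrt _); rewrite mulr_sumr; apply: eq_bigr => t _; rewrite !mxE.
by rewrite opprD addrA subrr sub0r normcN normcM exprMn normc_real ger0_norm// normcB.
Qed.

(** If [p] were outside [W], the supremum of the parameters up to which the segment from [a] to [p]
    stays in the interior would give a boundary point at distance at most [e] from [a]. *)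
Lemma ball_interior (W : set 'rV[R[i]]_k) a p (e : R) : W° a ->
  (e%:E < dist_set a (boundary W))%E -> euclid_dist a p <= e -> W p.
Proof.
move=> Wa far pe; apply: contrapT => nWp.
pose line (c : R) := a + c%:C *: (p - a).
have near_line c (U : set 'rV[R[i]]_k) : nbhs (line c) U ->
    exists2 d : R, 0 < d & forall c', `|c' - c| < d -> U (line c').
  move=> /nbhs_rV[d d0 dU]; pose M := \sum_t normc ((p - a) 0 t).
  have M0 : 0 <= M by apply: sumr_ge0 => t _; apply: normc_ge0.
  exists (d / (M + 1)); first by rewrite divr_gt0// ltr_wpDl.
  move=> c' cc; apply: dU => t; rewrite !mxE opprD addrACA subrr add0r -mulrBl -rmorphB.
  rewrite normcM normc_real; have tM : normc (p 0 t - a 0 t) <= M.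
    rewrite /M (bigD1 t)//= !mxE lerDl; apply: sumr_ge0 => i _; exact: normc_ge0.
  apply: (@le_lt_trans _ _ (`|c' - c| * (M + 1))).
    by rewrite ler_wpM2l// (le_trans tM)// lerDl.
  by rewrite -ltr_pdivlMr// ltr_wpDl.
pose E : set R := [set c | 0 <= c <= 1 /\ forall c', 0 <= c' <= c -> W° (line c')].
have l0 : line 0 = a by rewrite /line scale0r addr0.
have E0 : E 0.
  split=> [|c' h]; first by rewrite lexx ler01.
  by rewrite (_ : c' = 0) ?l0//; apply/eqP; rewrite eq_sym eq_le.
have ubE : ubound E 1 by move=> c [/andP[]].
have hE : has_sup E by split; [exists 0|exists 1].
set c := sup E.
have c0 : 0 <= c by apply: ub_le_sup => //; exists 1.
have c1 : c <= 1 by apply: ge_sup => //; exists 0.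
have before c' : 0 <= c' -> c' < c -> W° (line c').
  move=> c'0 c'c; have d0 : 0 < c - c' by rewrite subr_gt0.
  have [x [_ xE] lt] := sup_adherent d0 hE; apply: xE.
  by rewrite c'0 /= ltW//; move: lt; rewrite -/c; lra.
have cd : euclid_dist a (line c) <= e.
  by rewrite (euclid_distZ a p c0) (le_trans _ pe)// ler_piMl// sqrtr_ge0.
have Wc : ~ W° (line c).
  move=> /nbhs_interior/near_line[d d0 dW].
  pose c2 := c + d / 2.
  have all c' : 0 <= c' -> c' <= c2 -> W° (line c').
    move=> c'0 c'c; have [lt|ge] := ltP c' c; first exact: before.
    apply: dW; rewrite ger0_norm ?subr_ge0//; move: c'c; rewrite /c2; lra.
  have [le|gt] := leP 1 c2.
    apply: nWp; have := all 1 ler01 le; rewrite /line scale1r addrC subrK.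
    exact: interior_subset.
  have : c2 <= c.
    apply: ub_le_sup; first by exists 1.
    split; first by apply/andP; split; rewrite /c2 in gt *; lra.
    by move=> c' /andP[]; apply: all.
  by rewrite /c2; lra.
have bd : boundary W (line c).
  split; last exact: Wc.
  move=> U /near_line[d d0 dU].
  have [c_eq0|cn0] := eqVneq c 0; first by case: Wc; rewrite c_eq0 l0.
  have cp : 0 < c by rewrite lt_def cn0.
  pose c' := Num.max 0 (c - d / 2).
  have c'0 : 0 <= c' by rewrite le_max lexx.
  have c'c : c' < c by rewrite gt_max cp /=; lra.
  exists (line c'); split; first by apply: interior_subset; apply: before.
  apply: dU; rewrite ltr0_norm; last by rewrite subr_lt0.
  have : c - d / 2 <= c' by rewrite le_max lexx orbT.
  by lra.
have : (dist_set a (boundary W) <= (euclid_dist a (line c))%:E)%E.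
  by apply: ereal_inf_lbound; exists (line c).
move=> /(lt_le_trans far); rewrite lte_fin => /lt_le_trans/(_ cd).
by rewrite ltxx.
Qed.

Lemma euclid_dist_le a p (r : R) : 0 <= r ->
  (forall t, normc (p 0 t - a 0 t) <= r) -> euclid_dist a p <= k%:R * r.
Proof.
move=> r0 h; rewrite -[leRHS]ger0_norm ?mulr_ge0// -sqrtr_sqr ler_wsqrtr//.
apply: (@le_trans _ _ (\sum_(t < k) r ^+ 2)).
  apply: ler_sum => t _; rewrite ler_pXn2r ?nnegrE ?normc_ge0//.
  by rewrite normcB.
rewrite sumr_const card_ord -[leLHS]mulr_natl exprMn ler_wpM2r ?sqr_ge0//.
by rewrite -natrX ler_nat; case: (k) => // k'; rewrite leq_pmulr.
Qed.

Lemma sup_norm_ge a t : normc (a 0 t) <= sup_norm a.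
Proof. by rewrite /sup_norm (bigD1 t)//= le_max lexx. Qed.

Lemma sup_norm_ge0 a : 0 <= sup_norm a.
Proof.
rewrite /sup_norm; elim/big_rec: _ => // t x _ x0.
by rewrite le_max x0 orbT.
Qed.

End ComplexSpaces.

(** * Transfer from the normed space to the inner product norm, and assembly *)

Section HilbertSpaces.
Variables (R : realType) (H : completeNormedModType R[i]).
Variable ip : {dot H for Num.conj}.
Hypothesis ip_norm : induces_norm ip.

Lemma hnormE x : `|x| = (hnorm ip x)%:C.
Proof.
rewrite ip_norm -hnorm_sqr rmorphXn /= sqrCK//.
by rewrite lecR hnorm_ge0.
Qed.

Lemma hilbert_complete (s : nat -> H) :
  (forall e, 0 < e -> exists n0, forall m n, (n0 <= m)%N -> (m <= n)%N ->
    hnorm ip (s n - s m) <= e) ->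
  exists l, forall e, 0 < e -> exists n0, forall n, (n0 <= n)%N ->
    hnorm ip (s n - l) <= e.
Proof.
move=> cs; have cv : cvg (s n @[n --> \oo]).
  apply: cauchy_cvg; apply: cauchy_exP => e /gt0_complexE [-> e0].
  have [n0 h] := cs _ (divr_gt0 e0 (ltr0n R 2)).
  exists (s n0); exists n0 => // n /= nn; rewrite -ball_normE /= hnormE ltcR hnormB.
  by apply: le_lt_trans (h n0 n (leqnn _) nn) _; lra.
exists (lim (s n @[n --> \oo])) => e /realC_gt0 e0.
have /cvgrPdist_le /(_ _ e0) [n0 _ h] := cv.
by exists n0 => n /h /=; rewrite hnormE lecR hnormB.
Qed.

Variables (k : nat) (T : 'I_k -> {linear H -> H}).

Lemma essentialE lam : ess_num_range ip T lam -> essential ip T (lam 0).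
Proof.
move=> [x [xo xl]]; exists x; split=> // t e e0.
have [n0 h] := cvg_rV_normc (xl t) e0.
by exists n0 => n /h; rewrite mxE.
Qed.

Lemma uniform_bound : (forall t, bounded_operator (T t)) -> exists K : R,
  1 <= K /\ forall t x, hnorm ip (T t x) <= K * hnorm ip x.
Proof.
move=> /choice[M hM]; exists (1 + \sum_t `|M t|); split.
  by rewrite lerDl; apply: sumr_ge0.
move=> t x; have := hM t x; rewrite !hnormE -rmorphM lecR => /le_trans; apply.
rewrite ler_wpM2r ?hnorm_ge0// (le_trans (ler_norm _))// (bigD1 t)//=.
by rewrite addrCA lerDl addr_ge0// sumr_ge0.
Qed.

End HilbertSpaces.

(** No injectivity of [f] is assumed, so the new coefficient is added to the one already at
    [f p]. *)
Lemma span_seq_sum (R : realType) (H : completeNormedModType R[i]) (u : nat -> H)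
    (f : nat -> nat) (c : nat -> R[i]) p :
  span_seq u (\sum_(i < p) c i *: u (f i)).
Proof.
elim: p => [|p [n [d e]]].
  by exists 0%N, (fun=> 0); rewrite !big_ord0.
pose m := maxn n (f p).+1.
have nm : (n <= m)%N by apply: leq_maxl.
have pm : (f p < m)%N by apply: leq_maxr.
exists m, (fun j => (if (j < n)%N then d j else 0) + (if j == f p then c p else 0)).
rewrite big_ord_recr /= e; under [RHS]eq_bigr do rewrite scalerDl.
rewrite big_split /=; congr (_ + _).
  rewrite (big_ord_widen m (fun j => d j *: u j) nm) big_mkcond /=.
  by apply: eq_bigr => j _; case: ifP; rewrite ?scale0r.
rewrite (bigD1 (Ordinal pm))//= eqxx big1 ?addr0// => j /negPf jp.
by rewrite (_ : (j == f p :> nat) = false) ?scale0r.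
Qed.

(** Lets a sequence indexed by [logn 2 i.+1] return to each of its terms forever, as the absorption
    of a vector needs. *)
Lemma infinitely_often (m N : nat) : exists2 i, (N <= i)%N & logn 2 i.+1 = m.
Proof.
have pos : (0 < 2 ^ m * N.*2.+1)%N by rewrite muln_gt0 expn_gt0.
exists (2 ^ m * N.*2.+1).-1; rewrite ?prednK//.
  rewrite -ltnS prednK// (leq_trans _ (leq_pmull _ _)) ?expn_gt0//.
  by rewrite ltnS -addnn leq_addl.
rewrite lognM ?expn_gt0// pfactorK// lognE /= dvdn2 /= odd_double /=.
by rewrite addn0.
Qed.

Theorem theorem1p5 (R : realType) (H : completeNormedModType R[i])
    (ip : {dot H for Num.conj}) (ip_norm : induces_norm ip)
    (H_sep : separable_space H) (H_inf : infinite_dimensional H)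
    (k : nat) (k_gt0 : (0 < k)%N)
    (T : 'I_k -> {linear H -> H}) (T_bounded : forall t, bounded_operator (T t))
    (W_int : (ess_num_range ip T)° !=set0)
    (eps : R) (eps_gt0 : 0 < eps) :
  exists delta : R, 0 < delta /\
    forall (B : set (nat * nat)) (a : nat -> nat -> 'rV[R[i]]_k),
      B `<=` ~` diagonal ->
      admissible B ->
      (forall n, (ess_num_range ip T)° (a n n) /\
        (eps%:E < dist_set (a n n) (boundary (ess_num_range ip T)))%E) ->
      (forall n,
        (\esum_(j in [set j | B (n, j)]) (sup_norm (a n j))%:E <= delta%:E)%E) ->
      (forall j,
        (\esum_(n in [set n | B (n, j)]) (sup_norm (a n j))%:E <= delta%:E)%E) ->
      exists u : nat -> H, orthonormal_basis ip u /\
        forall n j, (B `|` diagonal) (n, j) ->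
          tuple_ip ip T (u j) (u n) = a n j.
Proof.
have [K [K1 TK]] := uniform_bound ip_norm T_bounded.
have complete := hilbert_complete ip_norm.
have kR : 0 < k%:R :> R by rewrite ltr0n.
(* Coordinates within [rho] give a Euclidean distance of at most [k * rho = eps]. *)
pose rho := eps / k%:R; have rho0 : 0 < rho by rewrite divr_gt0.
have [[s' C] [/= s'0 C1 ext']] := extension K1 TK complete k_gt0 rho0.
pose s := Num.min s' 1.
have s0 : 0 < s by rewrite lt_min s'0 ltr01.
have s1 : s <= 1 by rewrite ge_min lexx orbT.
have ss' : s <= s' by rewrite ge_min lexx.
have ext a z V (ga : good ip T a rho) (zs : hnorm ip z ^+ 2 <= s) :=
  ext' a z V ga (le_trans zs ss').
pose mm := nforms R k; have mm1 : 1 <= mm by apply: nforms_ge1.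
pose gr := growth k K C; have gr1 : 1 <= gr by apply: growth_ge1.
have m2 : mm <= mm ^+ 2 by rewrite expr2 ler_peMl// (le_trans ler01).
have m2g : 1 <= mm ^+ 2 * gr by rewrite mulr_ege1// (le_trans mm1).
have mg : mm * gr <= mm ^+ 2 * gr by rewrite ler_wpM2r// (le_trans ler01).
have den0 : 0 < 24 * (mm ^+ 2 * gr) by lra.
(* The factor 24 comes from the condition [6 * mm * gr * del <= 1/4]; [s] and [mm ^+ 2] serve the
   norm threshold. *)
pose del := s / (24 * (mm ^+ 2 * gr)).
have del0 : 0 < del by rewrite divr_gt0.
have delm : 24 * (mm ^+ 2 * gr * del) = s.
  by rewrite /del; field; rewrite !gt_eqF//; lra.
have delmg : 24 * (mm * gr * del) <= s.
  by rewrite -delm ler_wpM2l// ler_wpM2r// ltW.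
have del1 : del <= 1.
  rewrite ler_pdivrMr//; lra.
exists (del / 4); split; first by rewrite divr_gt0.
move=> B a Bdiag adm diag rows cols.
have [f [f' [fK f'K free]]] := @free_reordering (fun n l => B (n, l)) adm.
have finj := can_inj fK.
pose h n l := if `[< B (f n, f l) >] then sup_norm (a (f n) (f l)) else 0.
have h0 n l : 0 <= h n l by rewrite /h; case: ifP => // _; apply: sup_norm_ge0.
have memE (P : nat -> Prop) j : (j \in [set j | P j]) = `[< P j >].
  by apply/idP/asboolP; rewrite inE.
have hrow n N : \sum_(l < N) h n l <= del / 4.
  have := esum_injective_le N (fun j => sup_norm_ge0 (a (f n) j)) finj (rows (f n)).
  by under eq_bigr do rewrite memE.
have hcol l N : \sum_(n < N) h n l <= del / 4.
  have := esum_injective_le N (fun n => sup_norm_ge0 (a n (f l))) finj (cols (f l)).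
  by under eq_bigr do rewrite memE.
(* Symmetrised to bound the entries in either order; a row and a column of [h], at most [del / 4]
   each, give the [del / 2] required of [F]. *)
pose b n l := h n l + h l n.
have b0 n l : 0 <= b n l by rewrite addr_ge0.
have bC n l : b n l = b l n by rewrite /b addrC.
have /choice[F FP] j : exists Fj : nat -> R, [/\ forall n, Fj n = b n j + Fj n.+1,
    forall n, 0 <= Fj n, Fj 0%N <= del / 2 &
    forall e, 0 < e -> exists n0, forall n, (n0 <= n)%N -> Fj n <= e].
  apply: series_tail => // N; rewrite big_split /=.
  by have := hrow j N; have := hcol j N; lra.
have FE j n : F j n = b n j + F j n.+1 by have [] := FP j.
have F0 j n : 0 <= F j n by have [] := FP j.
have Fdel j : F j 0%N <= del / 2 by have [] := FP j.
have Flim j e : 0 < e -> exists n0, forall n, (n0 <= n)%N -> F j n <= e.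
  by have [_ _ _] := FP j; apply.
pose B' n l := B (f n, f l); pose a' n l t := a (f n) (f l) 0 t.
have hB n l t : B' n l -> normc (a' n l t) <= h n l.
  by move=> Bnl; rewrite /h asboolT// sup_norm_ge.
have ab n l t : B' n l -> normc (a' n l t) <= b n l.
  by move=> /(hB n l t) /le_trans; apply; rewrite lerDl.
have ab' n l t : B' l n -> normc (a' l n t) <= b n l.
  by move=> /(hB l n t) /le_trans; apply; rewrite lerDr.
have gd n : good ip T (a' n n) rho.
  move=> p pa; have [Wa far] := diag (f n).
  pose q : 'rV[R[i]]_k := \row_t p t.
  have -> : p = q 0 by apply/funext => t; rewrite mxE.
  suff : ess_num_range ip T q by apply: essentialE.
  apply: (ball_interior Wa far).
  have -> : eps = k%:R * rho by rewrite /rho mulrC divfK// gt_eqF.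
  apply: euclid_dist_le; first exact: ltW.
  by move=> t; rewrite mxE; apply: pa.
have [A [Acount Adense]] := H_sep.
have /countable_injP[num numi] := Acount.
have /choice[pts ptsP] n : exists x : H, forall y, y \in A -> num y = n -> x = y.
  have [[y [yA yn]]|none] := pselect (exists y, y \in A /\ num y = n).
    by exists y => z zA zn; apply: numi => //; rewrite yn zn.
  by exists 0 => y yA yn; case: none; exists y.
(* Absorption requires norm at most 1; the 1 in the denominator covers [y = 0]. *)
pose unit_of y : H := (1 + hnorm ip y)^-1%:C *: y.
pose g i := unit_of (pts (logn 2 i.+1)).
have g1 i : hnorm ip (g i) <= 1.
  have y0 := hnorm_ge0 ip (pts (logn 2 i.+1)).
  rewrite hnormZ normc_real ger0_norm ?invr_ge0 ?addr_ge0//.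
  by rewrite mulrC ler_pdivrMr ?mul1r ?lerDr// ltr_pwDl.
have [u' [uo uB ug]] : exists u : nat -> H, [/\ forall i j, ip (u i) (u j) = (i == j)%:R,
    forall i j t, B' i j \/ i = j -> ip (T t (u j)) (u i) = a' i j t &
    forall i, exists2 p, (i <= p)%N &
      ip (g i) (u p) = (Num.sqrt s * hnorm ip (residual ip p u (g i)) ^+ 2)%:C].
  apply: (@prescribed_system _ _ _ _ _ K _ _ rho s C _ _ _ B' a' _ b _ _ _ _ _ _ del _ _ _ _ F) => //.
  - by rewrite -/mm -/gr; lra.
  - by rewrite -/mm -/gr; lra.
  - rewrite -/mm -/gr.
    have : mm ^+ 2 * gr * del * del <= mm ^+ 2 * gr * del * 1.
      by rewrite ler_wpM2l// mulr_ge0 ?(ltW del0)// (le_trans ler01).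
    by lra.
pose u j := u' (f' j).
exists u; split; last first.
  move=> n j Bnj; apply/rowP => t; rewrite mxE /u uB ?/a' ?f'K//.
  by case: Bnj => [Bnj|nj]; [left; rewrite /B' !f'K|right; rewrite (nj : n = j)].
split=> [m n|O [x Ox] Oopen].
  by rewrite /u uo (inj_eq (can_inj f'K)).
have [y [Oy Ay]] := Adense O (ex_intro _ x Ox) Oopen.
have /nbhs_ballP[e /= ep eO] : nbhs y O by apply: open_nbhs_nbhs.
have [eE e0] := gt0_complexE ep; set e' := complex.Re e in eE e0.
have ny := hnorm_ge0 ip y; have ny1 : 0 < 1 + hnorm ip y by rewrite ltr_pwDl.
have gy N : exists2 i, (N <= i)%N & g i = unit_of y.
  have [i Ni ie] := infinitely_often (num y) N; exists i => //.
  by rewrite /g ie (ptsP _ y)//; apply/mem_set.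
(* The denominator undoes the scaling of [unit_of], and the half turns the non-strict bound on the
   residual into the strict one of the open ball. *)
have d0 : 0 < e' / 2 / (1 + hnorm ip y) by rewrite divr_gt0// divr_gt0.
have [|p rp] := residual_lim0 (g := unit_of y) s0 uo _ d0.
  move=> N; have [i Ni gi] := gy N; have [p ip' up] := ug i.
  by exists p; [apply: leq_trans ip'|rewrite -gi].
pose z := \sum_(i < p) ((1 + hnorm ip y)%:C * ip (unit_of y) (u' i)) *: u' i.
exists z; split; last first.
  rewrite /z; under eq_bigr do rewrite -[in X in _ *: X](fK (nat_of_ord _)) -/(u _).
  exact: (span_seq_sum u f
    (fun i => (1 + hnorm ip y)%:C * ip (unit_of y) (u' i)) p).
have yE : (1 + hnorm ip y)%:C *: unit_of y = y.
  by rewrite /unit_of scalerA -rmorphM mulfV ?scale1r// gt_eqF.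
apply: eO; rewrite -ball_normE /= eE (hnormE ip_norm) ltcR.
have -> : y - z = (1 + hnorm ip y)%:C *: residual ip p u' (unit_of y).
  rewrite /residual scalerBr yE scaler_sumr; congr (_ - _).
  by apply: eq_bigr => i _; rewrite scalerA.
rewrite hnormZ normc_real ger0_norm ?(ltW ny1)//.
move: rp; rewrite ler_pdivlMr// mulrC; lra.
Qed.
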